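(* Let $\gamma$ be a graphon with edge density $p>0$ such that, as functions of $z$ in the open unit disc $\mathbb{D}=\{|z|<1\}$, we have either the convergence in probability $$\det\!\left(I_n+z\,\frac{A_n(\gamma)}{n}\right)\longrightarrow_{n\to\infty}(1+pz)\,e^{-pz-\frac{p(1-p)z^2}{2}},$$ or the convergence in expectation $$\mathbb{E}\!\left[\det\!\left(I_n+z\,\frac{A_n(\gamma)}{n}\right)\right]\longrightarrow_{n\to\infty}(1+pz)\,e^{-pz-\frac{p(1-p)z^2}{2}}.$$ Then $\gamma=\gamma_p$.
   Context: A graph function is a measurable symmetric $g:[0,1]^2\to[0,1]$ (up to null sets); a graphon $\gamma=[g]$ is an equivalence class of graph functions for the relation $\delta_\square=0$, where $\delta_\square$ is the cut-metric $\inf_\sigma \sup_{S,T}|\int_{S\times T}(g_1(\sigma(x),\sigma(y))-g_2(x,y))\,dx\,dy|$, $\sigma$ running over measure-preserving measurable bijections of $[0,1]$ and $S,T$ over measurable subsets. The edge density of $\gamma$ is $p=\int_{[0,1]^2}g$. The graphon $\gamma_p$ is the class of the constant graph function equal to $p$. The $W$-random graph $G_n(\gamma)$ has vertex set $\{1,\dots,n\}$; with $(X_i)$ and $(U_{ij})_{i<j}$ independent uniform on $[0,1]$, $i<j$ are connected iff $U_{ij}\le g(X_i,X_j)$. $A_n(\gamma)$ is its adjacency matrix. Convergence of (random) holomorphic functions of $z$ is for the topology of locally uniform convergence on $\mathbb{D}$. *)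

(* Defs.v *)
From HB Require Import structures.
From mathcomp Require Import all_boot all_order all_algebra.
From mathcomp Require Import complex.
From mathcomp Require Import all_classical all_reals all_analysis.

Set Implicit Arguments.
Unset Strict Implicit.
Unset Printing Implicit Defensive.

Import Order.TTheory GRing.Theory Num.Theory.
Import numFieldNormedType.Exports.

Local Open Scope classical_set_scope.
Local Open Scope complex_scope.
Local Open Scope ring_scope.

Section Graphons.
Context {R : realType}.
Implicit Types (g h : R * R -> R) (s : R -> R) (S T A : set R).

Definition unit_itv : set R := `[0, 1]%classic.

Definition lebesgue2 := (@lebesgue_measure R \x @lebesgue_measure R)%E.

(* A function on the unit square is represented by a Borel extension to the
   plane; the values outside the unit square play no role. *)
Record graph_function g : Prop := GraphFunction {
  graph_function_measurable : measurable_fun [set: R * R] g;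
  graph_function_sym : forall x y, unit_itv x -> unit_itv y ->
    g (x, y) = g (y, x);
  graph_function_itv : forall x y, unit_itv x -> unit_itv y ->
    0 <= g (x, y) <= 1 }.

Record mp_bijection s : Prop := MpBijection {
  mp_bijection_measurable : measurable_fun unit_itv s;
  mp_bijection_bij : set_bij unit_itv unit_itv s;
  mp_bijection_preserving : forall A, measurable A -> A `<=` unit_itv ->
    lebesgue_measure (unit_itv `&` s @^-1` A) = lebesgue_measure A }.

Definition cut_discrepancy g h s : R :=
  sup [set r | exists S T,
    [/\ measurable S, S `<=` unit_itv, measurable T, T `<=` unit_itv &
      r = `| \int[lebesgue2]_(xy in S `*` T)
               (g (s xy.1, s xy.2) - h xy) |]].

Definition cut_distance g h : R :=
  inf [set cut_discrepancy g h s | s in mp_bijection].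

Definition graphon g : set (R * R -> R) :=
  [set h | graph_function h /\ cut_distance g h = 0].

Definition edge_density g : R :=
  \int[lebesgue2]_(xy in unit_itv `*` unit_itv) g xy.

Definition constant_graphon (p : R) : set (R * R -> R) := graphon (cst p).

End Graphons.

Section RandomGraph.
Context {R : realType}.

Definition mutually_independent {d} {T : measurableType d}
    (P : probability T R) (I : finType) (D : {set I})
    (Y : I -> {RV P >-> R}) : Prop :=
  forall J : {set I}, J \subset D ->
  forall B : I -> set R, (forall k, measurable (B k)) ->
    P (\bigcap_(k in [set` J]) (Y k @^-1` B k)) =
    (\prod_(k in J) P (Y k @^-1` B k))%E.

Definition uniform01 {d} {T : measurableType d} (P : probability T R)
    (Y : {RV P >-> R}) : Prop :=
  forall B : set R, measurable B ->
    distribution P Y B = uniform_prob (@ltr01 R) B.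

Definition joint_family {d} {T : measurableType d} (P : probability T R)
    (n : nat) (X : 'I_n -> {RV P >-> R}) (U : 'I_n -> 'I_n -> {RV P >-> R})
    (k : 'I_n + 'I_n * 'I_n) : {RV P >-> R} :=
  match k with inl i => X i | inr ij => U ij.1 ij.2 end.

(* Only the [U i j] with [i < j] are constrained. *)
Definition joint_index (n : nat) : {set 'I_n + 'I_n * 'I_n} :=
  [set k : 'I_n + 'I_n * 'I_n |
    match k with inl _ => true | inr ij => (ij.1 < ij.2)%N end]%SET.

Definition iid_uniform {d} {T : measurableType d} (P : probability T R)
    (n : nat) (X : 'I_n -> {RV P >-> R}) (U : 'I_n -> 'I_n -> {RV P >-> R}) :
    Prop :=
  mutually_independent (joint_index n) (joint_family X U) /\
  {in joint_index n, forall k, uniform01 (joint_family X U k)}.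

Definition W_graph (n : nat) (g : R * R -> R) (x : 'I_n -> R)
    (u : 'I_n -> 'I_n -> R) : rel 'I_n :=
  fun i j => ((i < j)%N && (u i j <= g (x i, x j)))
          || ((j < i)%N && (u j i <= g (x j, x i))).

Definition adjacency_mx (n : nat) (e : rel 'I_n) : 'M[R[i]]_n :=
  \matrix_(i, j) (e i j)%:R.

Definition W_adjacency {d} {T : measurableType d} (P : probability T R)
    (n : nat) (g : R * R -> R) (X : 'I_n -> {RV P >-> R})
    (U : 'I_n -> 'I_n -> {RV P >-> R}) (w : T) : 'M[R[i]]_n :=
  adjacency_mx (W_graph g (fun i => X i w) (fun i j => U i j w)).

Definition scaled_det (n : nat) (A : 'M[R[i]]_n) (z : R[i]) : R[i] :=
  \det (1%:M + z *: (n%:R^-1 *: A)).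

End RandomGraph.

Definition unit_disc (R : realType) : set R[i] := [set z | `|z| < 1].

(* Functions are total, but the topology does not see their values outside the
   unit disc. The regular algebra [(R[i])^o] carries the topology of the
   modulus. *)
Notation disc_functions R :=
  {family compactly_in (unit_disc (R := R) : set (R[i])^o),
    (R[i])^o -> (R[i])^o}.

Section Convergence.
Context {R : realType}.

Definition cvg_in_probability {d : nat -> measure_display}
    {T : forall n, measurableType (d n)} (P : forall n, probability (T n) R)
    {E : topologicalType} (F : forall n, T n -> E) (l : E) : Prop :=
  forall N : set E, nbhs l N ->
    P n [set w | ~ N (F n w)] @[n --> \oo] --> 0%E.

Definition complex_expectation {d} {T : measurableType d}
    (P : probability T R) (F : T -> R[i]) : R[i] :=
  fine ('E_P[fun w => complex.Re (F w)]) +i*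
  fine ('E_P[fun w => complex.Im (F w)]).

Definition cexp (z : R[i]) : R[i] :=
  (expR (complex.Re z) * cos (complex.Im z)) +i*
  (expR (complex.Re z) * sin (complex.Im z)).

Definition limit_det (p : R) (z : R[i]) : R[i] :=
  (1 + p%:C * z) * cexp (- (p%:C * z) - p%:C * (1 - p%:C) * z ^+ 2 / 2).

End Convergence.

(* Main.v *)
Require Import Defs.
From HB Require Import structures.
From mathcomp Require Import all_boot all_order all_algebra.
From mathcomp Require Import perm complex.
From mathcomp Require Import all_classical all_reals all_analysis.
From mathcomp Require Import measurable_realfun.
From mathcomp Require Import zify ring lra.

Set Implicit Arguments.
Unset Strict Implicit.
Unset Printing Implicit Defensive.

Import Order.TTheory GRing.Theory Num.Theory.
Import numFieldNormedType.Exports.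

Local Open Scope classical_set_scope.
Local Open Scope complex_scope.
Local Open Scope ring_scope.

(** The theorem holds because the coefficient of z^4 in the limit already forces
    the density of 4-cycles in the graphon to be p^4, and by Chung, Graham and
    Wilson this together with the edge density p makes the graphon constant.

    Coefficients. The determinant of 1 + x B is the sum over J of x^|J| times the
    principal minor of B on J ([det_1_add_scale], [det_partial_mx]). For a 0/1
    matrix A such a minor is at most |J|! in modulus, so the coefficient of x^k in
    det (1 + x A / n) is at most n (n - 1) ... (n - k + 1) / n^k <= 1 in modulus
    ([normr_det_coef]). Because of this uniform bound no complex analysis is
    needed: real arguments suffice, convergence in probability at a point implies
    convergence of expectations ([mean_real_det_cvg]), and a symmetric fourth
    difference at scale h isolates the coefficient of order 4 up to O(h^5),
    uniformly in n ([taylor4_coef_limit]).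

    The coefficient of order 4. A 4 x 4 symmetric 0/1 matrix with zero diagonal
    has determinant (number of perfect matchings) - 2 (number of 4-cycles)
    ([det4_symmetric_hollow]). By independence the expected minor is therefore
    3 p^2 - 6 t, with t the 4-cycle density ([mean_det_partial_mx4]), and the
    coefficient of x^4 tends to (3 p^2 - 6 t) / 24. In the Taylor expansion of
    (1 + p x) exp (- p x - p (1 - p) x^2 / 2) it is (3 p^2 - 6 p^4) / 24
    ([real_limit_det_taylor4]). Hence t = p^4.

    Quasi-randomness. Write K for the codegree and D for the degree. Since t is
    the integral of K^2 and the integral of K is that of D^2, t = p^4 gives
      int (K - p^2)^2 = - 2 p^2 int (D - p)^2,
    so both sides vanish: K = p^2 and D = p almost everywhere. Expanding the
    square, the integral over x of (int phi(y) (g(x,y) - p) dy)^2 then vanishes for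
    each bounded phi ([quadratic_form_eq0]), so g and p have the same integral on
    every rectangle, hence agree almost everywhere ([ae_constant_of_cycle4]).

    Conclusion. Replacing g by p changes no cut discrepancy, since x |-> s x acts
    on both coordinates by a map that preserves null sets of the square
    ([cut_discrepancy_ae_constant]). *)

(** * Principal minors and the expansion of det (1 + x B) *)

(** Sylvester's identity: the two determinants are those of the two products of
    the block matrices [1, -A; B, 1] and [1, A; 0, 1]. *)
Lemma det_add_mulmx_sym (R : comPzRingType) (m n : nat)
    (A : 'M[R]_(m, n)) (B : 'M[R]_(n, m)) :
  \det (1%:M + A *m B) = \det (1%:M + B *m A).
Proof.
have e1 : block_mx 1%:M (- A) B 1%:M *m block_mx 1%:M A 0 1%:M
          = block_mx 1%:M 0 B (1%:M + B *m A).
  rewrite mulmx_block !mul1mx !mulmx1 !mulmx0 !addr0 subrr.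
  by rewrite addrC.
have e2 : block_mx 1%:M A 0 1%:M *m block_mx 1%:M (- A) B 1%:M
          = block_mx (1%:M + A *m B) 0 B 1%:M.
  by rewrite mulmx_block !mul1mx !mulmx1 !mul0mx !add0r addNr.
have := congr1 determinant e1; have := congr1 determinant e2.
rewrite !det_mulmx !det_lblock det_ublock !det1 !mul1r !mulr1 => -> ->.
by [].
Qed.

(** The determinant of this matrix is the principal minor of [B] on [J], while its
    size stays [n]; the sum over [J] can thus be exchanged with the Leibniz sum
    over permutations of ['I_n]. *)
Definition partial_mx (R : pzSemiRingType) (n : nat) (B : 'M[R]_n) (J : {set 'I_n}) :=
  \matrix_(i, j) (if i \in J then B i j else (i == j)%:R).

(** With [S] the matrix that selects the rows of [J], [partial_mx B J] is
    [1 + S^T (S B - S)], and Sylvester's identity turns its determinant into that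
    of [1 + (S B - S) S^T = S B S^T]. *)
Lemma det_partial_mx (R : comPzRingType) (n k : nat) (B : 'M[R]_n)
    (J : {set 'I_n}) (f : 'I_k -> 'I_n) :
  injective f -> J =i codom f ->
  \det (partial_mx B J) = \det (mxsub f f B).
Proof.
move=> f_inj Jf.
pose S : 'M[R]_(k, n) := rowsub f 1%:M.
have SE l (C : 'M[R]_(n, l)) : S *m C = rowsub f C by rewrite mul_rowsub_mx mul1mx.
have -> : partial_mx B J = 1%:M + S^T *m (S *m B - S).
  rewrite SE; apply/matrixP=> i j; rewrite !mxE.
  under eq_bigr => l _ do rewrite !mxE.
  case: ifPn => [iJ|iJ].
    have /codomP[l il] : i \in codom f by rewrite -Jf.
    rewrite (bigD1 l) //= big1 => [|l' l'l]; last first.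
      by rewrite il (inj_eq f_inj) (negbTE l'l) mul0r.
    by rewrite addr0 -il eqxx mul1r addrC subrK.
  rewrite big1 ?addr0 // => l _; case: eqVneq => [fl|]; last by rewrite mul0r.
  by rewrite Jf -fl codom_f in iJ.
rewrite det_add_mulmx_sym mulmxBl.
have -> : S *m S^T = 1%:M.
  apply/matrixP=> i j; rewrite SE !mxE eq_sym.
  by rewrite (inj_eq f_inj).
rewrite addrC subrK SE; congr (\det _); apply/matrixP=> i j.
rewrite !mxE (bigD1 (f j)) //= big1 => [|l lfj]; last first.
  by rewrite !mxE eq_sym (negbTE lfj) mulr0.
by rewrite !mxE eqxx mulr1 addr0.
Qed.

(** Each factor of the Leibniz formula is a sum of an entry of [x *: B] and one of
    the identity; [J] records the rows where the former is chosen. *)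
Lemma det_1_add_scale (R : comPzRingType) (n : nat) (x : R) (B : 'M[R]_n) :
  \det (1%:M + x *: B) =
  \sum_(J : {set 'I_n}) x ^+ #|J| * \det (partial_mx B J).
Proof.
rewrite /determinant.
under eq_bigr => s _.
  under eq_bigr => i _ do rewrite !mxE addrC.
  rewrite bigA_distr mulr_sumr; over.
rewrite exchange_big /=; apply: eq_bigr => J _.
rewrite mulr_sumr; apply: eq_bigr => s _; rewrite mulrCA; congr (_ * _).
rewrite -prodr_const [X in X * _]big_mkcond -big_split /=; apply: eq_bigr => i _.
by rewrite !mxE; case: ifP => _; rewrite ?mul1r.
Qed.

Lemma normr_det_le_fact (R : numDomainType) (n : nat) (A : 'M[R]_n) :
  (forall i j, `|A i j| <= 1) -> `|\det A| <= n`!%:R.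
Proof.
move=> A1; apply: le_trans (ler_norm_sum _ _ _) _.
rewrite -card_Sn -sum1_card natr_sum; apply: ler_sum => s _.
rewrite normrM normr_sign mul1r normr_prod.
by apply: prodr_ile1 => i _; rewrite normr_ge0 A1.
Qed.

(** Only derangements of four points contribute: the three double transpositions
    give the squares, the six 4-cycles give each cyclic product twice. *)
Lemma det4_symmetric_hollow (R : comPzRingType) (A : 'M[R]_4) :
  (forall i j, A i j = A j i) -> (forall i, A i i = 0) ->
  let a i j := A (inord i) (inord j) in
  \det A = (a 0%N 1%N * a 2%N 3%N) ^+ 2 + (a 0%N 2%N * a 1%N 3%N) ^+ 2
         + (a 0%N 3%N * a 1%N 2%N) ^+ 2
         - 2%:R * (a 0%N 1%N * a 1%N 2%N * a 2%N 3%N * a 3%N 0%N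
                 + a 0%N 1%N * a 1%N 3%N * a 3%N 2%N * a 2%N 0%N
                 + a 0%N 2%N * a 2%N 1%N * a 1%N 3%N * a 3%N 0%N).
Proof.
move=> Asym A0 a.
rewrite (expand_det_row _ ord0) /cofactor !big_ord_recl big_ord0 /=.
rewrite !(expand_det_row _ ord0) /cofactor !big_ord_recl !big_ord0 /=.
rewrite !(expand_det_row _ ord0) /cofactor !big_ord_recl !big_ord0 /=.
rewrite !det_mx11 !mxE.
have aE i j : A i j = a i j by rewrite /a !inord_val.
have asym i j : a i j = a j i by exact: Asym.
have a0 i : a i i = 0 by exact: A0.
clearbody a; rewrite !aE /= /bump /= !a0.
rewrite (asym 1 0)%N (asym 2 0)%N (asym 3 0)%N (asym 2 1)%N (asym 3 1)%N (asym 3 2)%N.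
ring.
Qed.

Lemma normr_det_partial_mx (R : numDomainType) (n : nat) (A : 'M[R]_n)
    (J : {set 'I_n}) :
  (forall i j, `|A i j| <= 1) -> `|\det (partial_mx A J)| <= (#|J|)`!%:R.
Proof.
move=> A1; rewrite (@det_partial_mx _ _ #|J| A J (@enum_val _ (mem J))).
- by apply: normr_det_le_fact => i j; rewrite mxE A1.
- exact: enum_val_inj.
- move=> i; apply/idP/codomP => [iJ|[l ->]]; last exact: enum_valP.
  by exists (enum_rank_in iJ i); rewrite enum_rankK_in.
Qed.

(** There are n choose k sets of size k, each contributing at most k!, and
    (n choose k) k! = n (n - 1) ... (n - k + 1). *)
Lemma normr_sum_det_partial_mx (R : numDomainType) (n k : nat) (A : 'M[R]_n) :
  (forall i j, `|A i j| <= 1) ->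
  `|\sum_(J : {set 'I_n} | #|J| == k) \det (partial_mx A J)| <= n%:R ^+ k.
Proof.
move=> A1; apply: le_trans (ler_norm_sum _ _ _) _.
apply: (@le_trans _ _ (\sum_(J : {set 'I_n} | #|J| == k) k`!%:R)).
  by apply: ler_sum => J /eqP <-; exact: normr_det_partial_mx.
rewrite sumr_const -cardsE card_draws card_ord -natrX -mulrnA ler_nat.
rewrite mulnC bin_ffact ffact_prod -[k in (_ ^ k)%N]card_ord -prod_nat_const.
by apply: leq_prod => i _; exact: leq_subr.
Qed.

(** * Taylor expansions to order four *)
Section Taylor.
Context {R : realType}.
Implicit Types (F : R -> R) (a b : nat -> R).

(** The combination of the values at 0, h, -h, 2h, -2h that kills 1, x, x^2, x^3 and
    sends x^4 to 24 h^4. *)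
Definition fourth_difference F (h : R) : R :=
  F (2 * h) - 4 * F h + 6 * F 0 - 4 * F (- h) + F (- (2 * h)).

Definition taylor4 F a (rho C : R) : Prop :=
  forall x, `|x| <= rho -> `|F x - \sum_(k < 5) a k * x ^+ k| <= C * `|x| ^+ 5.

(** The error is at most C h^5 (2 * 2^5 + 2 * 4) = 72 C h^5, as the expansion is
    exact at 0. *)
Lemma fourth_difference_taylor4 F a rho C (h : R) :
  0 <= h -> 2 * h <= rho -> taylor4 F a rho C ->
  `|fourth_difference F h - 24 * a 4%N * h ^+ 4| <= 72 * C * h ^+ 5.
Proof.
move=> h0 h8 FT.
have T x : - rho <= x <= rho -> `|F x - \sum_(k < 5) a k * x ^+ k| <= C * `|x| ^+ 5.
  by move=> ?; apply: FT; rewrite ler_norml.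
have := T (2 * h); have := T h; have := T 0; have := T (- h).
have := T (- (2 * h)).
rewrite !normrN !big_ord_recl !big_ord0 /= normr0 !(ger0_norm h0) (@ger0_norm _ (2 * h)); last by lra.
rewrite /bump /= (expr0n _ 5) /= mulr0 => T1 T2 T3 T4 T5.
have {}T1 : _ := T1 ltac:(lra). have {}T2 := T2 ltac:(lra).
have {}T3 := T3 ltac:(lra). have {}T4 := T4 ltac:(lra).
have {}T5 := T5 ltac:(lra).
have -> : 72 * C * h ^+ 5 = C * (2 * h) ^+ 5 + 4 * (C * h ^+ 5) + 6 * 0 +
  4 * (C * h ^+ 5) + C * (2 * h) ^+ 5 by ring.
move: T1 T2 T3 T4 T5; rewrite /fourth_difference !ler_norml.
set H := C * (2 * h) ^+ 5; set K := C * h ^+ 5.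
move=> T1 T2 T3 T4 T5.
lra.
Qed.

Lemma geometric_half_le2 (x : R) N : `|x| <= 2^-1 ->
  \sum_(k < N) `|x| ^+ k <= 2.
Proof.
move=> x2; apply: (@le_trans _ _ (2 - 2 * 2^-1 ^+ N)); last first.
  by rewrite gerBl mulr_ge0// exprn_ge0// invr_ge0.
elim: N => [|N IH]; first by rewrite big_ord0 expr0 mulr1 subrr.
rewrite big_ord_recr /=.
have := lerXn2r N (normr_ge0 x) _ x2.
have -> : 2 - 2 * 2^-1 ^+ N.+1 = 2 - 2 * 2^-1 ^+ N + 2^-1 ^+ N :> R.
  by rewrite exprS; field.
by move=> H; apply: lerD => //; apply: H; rewrite nnegrE invr_ge0.
Qed.

(** The constant does not depend on the degree: this is what makes the limit in
    [n] and the expansion in [x] commute. *)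
Lemma taylor4_polynomial (N : nat) b :
  (forall k, `|b k| <= 1) ->
  taylor4 (fun x => \sum_(k < N + 5) b k * x ^+ k) b 2^-1 2.
Proof.
move=> b1 x x2; rewrite addnC big_split_ord /= addrAC subrr add0r.
apply: le_trans (ler_norm_sum _ _ _) _.
apply: (@le_trans _ _ (`|x| ^+ 5 * \sum_(k < N) `|x| ^+ k)).
  rewrite mulr_sumr; apply: ler_sum => k _.
  by rewrite normrM normrX exprD ler_piMl// mulr_ge0// exprn_ge0.
by rewrite mulrC ler_wpM2r ?exprn_ge0// geometric_half_le2.
Qed.

(** The partial sums of the exponential series have coefficients at most 1. *)
Lemma expR_taylor4 : taylor4 expR (fun k => k`!%:R^-1) 2^-1 2.
Proof.
move=> x x4.
suff : series (exp_coeff x) n - \sum_(k < 5) k`!%:R^-1 * x ^+ k @[n --> \oo] -->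
    expR x - \sum_(k < 5) k`!%:R^-1 * x ^+ k.
  move/cvg_norm => cv; rewrite -(cvg_lim _ cv)//.
  apply: limr_le; first by apply/cvg_ex; eexists; exact: cv.
  near=> n; have n5 : (5 <= n)%N by near: n; exists 5%N.
  rewrite /series /= -(subnK n5) big_mkord.
  rewrite (eq_bigr (fun k : 'I__ => k`!%:R^-1 * x ^+ k)) => [|k _]; last first.
    by rewrite /exp_coeff /= mulrC.
  apply: (@taylor4_polynomial (n - 5) (fun k => k`!%:R^-1)) => // k.
  by rewrite ger0_norm ?invr_ge0 ?ler0n// invf_le1 ?ltr0n ?fact_gt0// ler1n fact_gt0.
apply: cvgB; last exact: cvg_cst.
exact: is_cvg_series_exp_coeff.
Unshelve. all: by end_near. Qed.

Lemma normr_horner_bounded (P : {poly R}) :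
  exists C : R, forall x : R, `|x| <= 1 -> `|P.[x]| <= C.
Proof.
exists (\sum_(i < size P) `|P`_i|) => x x1; rewrite horner_coef.
apply: le_trans (ler_norm_sum _ _ _) _; apply: ler_sum => i _.
by rewrite normrM normrX ler_piMr// exprn_ile1.
Qed.

Definition real_limit_det (p x : R) : R :=
  (1 + p * x) * expR (- (p * x) - p * (1 - p) * x ^+ 2 / 2).

(** With s = p (1 - p) / 2 the exponent is u = - x (p + s x). Multiplying the
    expansion of exp u by 1 + p x leaves the listed coefficients plus x^5 r(x),
    where the polynomial r collects the terms A and B of (p + s x)^3 and
    (p + s x)^4 beyond those of low degree. The radius 1/4 keeps |u| <= 1/2. *)
Lemma real_limit_det_taylor4 (p : R) : 0 <= p <= 1 ->
  exists a (C : R), taylor4 (real_limit_det p) a 4^-1 C /\ a 4%N = p ^+ 2 / 8 - p ^+ 4 / 4.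
Proof.
move=> /andP[p0 p1].
pose s := p * (1 - p) / 2.
pose A : {poly R} := (3 * p * s ^+ 2)%:P + (s ^+ 3)%:P * 'X.
pose B : {poly R} := (4 * p ^+ 3 * s)%:P + (6 * p ^+ 2 * s ^+ 2)%:P * 'X
  + (4 * p * s ^+ 3)%:P * 'X ^+ 2 + (s ^+ 4)%:P * 'X ^+ 3.
pose r : {poly R} := (p * (s ^+ 2 / 2 - p ^+ 2 * s / 2 + p ^+ 4 / 24))%:P
  + (1 + p%:P * 'X) * (24^-1%:P * B - 6^-1%:P * A).
have [C rC] := normr_horner_bounded r.
exists (nth 0 [:: 1; 0; p ^+ 2 / 2 - s - p ^+ 2;
   p * s - p ^+ 3 / 6 + p ^+ 3 / 2 - p * s;
   s ^+ 2 / 2 - p ^+ 2 * s / 2 + p ^+ 4 / 24 + p ^+ 2 * s - p ^+ 4 / 6]).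
exists (128 + C); split; last by rewrite /= /s; field.
move=> x x4; set T := \sum_(k < 5) _.
pose u := - (p * x) - p * (1 - p) * x ^+ 2 / 2.
have u2 : `|u| <= 2 * `|x|.
  have -> : u = - (x * (p + s * x)) by rewrite /u /s; field.
  rewrite normrN normrM mulrC ler_wpM2r//.
  have s0 : 0 <= s by rewrite /s divr_ge0// mulr_ge0// subr_ge0.
  have s1 : s <= 1 by rewrite /s; nra.
  apply: le_trans (ler_normD _ _) _; rewrite (ger0_norm p0).
  by rewrite normrM (ger0_norm s0); nra.
have px2 : `|1 + p * x| <= 2.
  by apply: le_trans (ler_normD _ _) _; rewrite normr1 normrM (ger0_norm p0); nra.
have E : `|expR u - \sum_(k < 5) k`!%:R^-1 * u ^+ k| <= 2 * `|u| ^+ 5.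
  by apply: expR_taylor4; lra.
have rE : (1 + p * x) * \sum_(k < 5) k`!%:R^-1 * u ^+ k - T = x ^+ 5 * r.[x].
  rewrite /r /A /B !hornerE /T !big_ord_recr !big_ord0 /= /u /s.
  rewrite (_ : 4`! = 24)%N// (_ : 3`! = 6)%N// (_ : 2`! = 2)%N// (_ : 1`! = 1)%N//.
  by rewrite fact0; field.
have -> : real_limit_det p x - T =
    (1 + p * x) * (expR u - \sum_(k < 5) k`!%:R^-1 * u ^+ k) + x ^+ 5 * r.[x].
  by rewrite -rE /real_limit_det -/u; ring.
apply: le_trans (ler_normD _ _) _; rewrite (normrM (1 + p * x)) (normrM (x ^+ 5)) normrX.
rewrite mulrDl lerD//; last by rewrite mulrC ler_wpM2r ?exprn_ge0// rC//; lra.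
apply: (@le_trans _ _ (2 * (2 * (2 * `|x|) ^+ 5))); last first.
  by rewrite exprMn le_eqVlt; apply/orP; left; apply/eqP; ring.
apply: ler_pM => //; apply: le_trans E _; rewrite ler_wpM2l//.
by rewrite lerXn2r ?nnegrE ?mulr_ge0.
Qed.
End Taylor.

(** * Integrals of bounded measurable functions *)

(** Under a probability measure, bounded measurable functions are integrable, and
    the class is stable under products, sections and partial integrals. Each
    Fubini or linearity step below then only asks for membership in the class. *)
Section BoundedMeasurable.
Context {d} {T : measurableType d} {R : realType}.
Implicit Types f g : T -> R.

Definition bounded_measurable f :=
  measurable_fun [set: T] f /\ exists M, forall x, `|f x| <= M.

Lemma bounded_measurable_cst (c : R) : bounded_measurable (fun=> c).
Proof. by split; [exact: measurable_cst|exists `|c|]. Qed.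

Lemma bounded_measurableD f g :
  bounded_measurable f -> bounded_measurable g ->
  bounded_measurable (fun x => f x + g x).
Proof.
move=> [mf [M fM]] [mg [N gN]]; split; first exact: measurable_funD.
by exists (M + N) => x; rewrite (le_trans (ler_normD _ _))// lerD.
Qed.

Lemma bounded_measurableM f g :
  bounded_measurable f -> bounded_measurable g ->
  bounded_measurable (fun x => f x * g x).
Proof.
move=> [mf [M fM]] [mg [N gN]]; split; first exact: measurable_funM.
by exists (M * N) => x; rewrite normrM ler_pM.
Qed.

Lemma bounded_measurableB f g :
  bounded_measurable f -> bounded_measurable g ->
  bounded_measurable (fun x => f x - g x).
Proof.
move=> [mf [M fM]] [mg [N gN]]; split; first exact: measurable_funB.
by exists (M + N) => x; rewrite (le_trans (ler_normB _ _))// lerD.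
Qed.

Lemma bounded_measurableX f n :
  bounded_measurable f -> bounded_measurable (fun x => f x ^+ n).
Proof.
move=> mf; elim: n => [|n IH]; first exact: bounded_measurable_cst.
by under eq_fun do rewrite exprS; exact: bounded_measurableM.
Qed.

Lemma bounded_measurable_sum I (r : seq I) (P : pred I) (f : I -> T -> R) :
  (forall i, bounded_measurable (f i)) ->
  bounded_measurable (fun x => \sum_(i <- r | P i) f i x).
Proof.
move=> mf; elim: r => [|i r IH].
  by under eq_fun do rewrite big_nil; exact: bounded_measurable_cst.
under eq_fun do rewrite big_cons.
by case: (P i) => //; apply: bounded_measurableD.
Qed.

Lemma bounded_measurable_prod I (r : seq I) (P : pred I) (f : I -> T -> R) :
  (forall i, bounded_measurable (f i)) ->
  bounded_measurable (fun x => \prod_(i <- r | P i) f i x).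
Proof.
move=> mf; elim: r => [|i r IH].
  by under eq_fun do rewrite big_nil; exact: bounded_measurable_cst.
under eq_fun do rewrite big_cons.
by case: (P i) => //; apply: bounded_measurableM.
Qed.

Lemma bounded_measurable_indic (A : set T) :
  measurable A -> bounded_measurable \1_A.
Proof.
move=> mA; split; first exact: measurable_indic.
by exists 1 => x; rewrite indicE; case: (_ \in _); rewrite ?normr1 ?normr0.
Qed.

Lemma bounded_measurable_ler f g :
  measurable_fun setT f -> measurable_fun setT g ->
  bounded_measurable (fun x => (f x <= g x)%R%:R).
Proof.
move=> mf mg.
have -> : (fun x => (f x <= g x)%R%:R) = \1_([set x | (f x <= g x)%R]) :> (T -> R).
  by apply/funext => x; rewrite indicE mem_setE.
apply: bounded_measurable_indic; rewrite -[X in measurable X]setTI.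
exact: measurable_fun_le.
Qed.

End BoundedMeasurable.

Lemma bounded_measurable_comp {d d'} {T : measurableType d}
    {T' : measurableType d'} {R : realType} (f : T' -> R) (phi : T -> T') :
  measurable_fun setT phi -> bounded_measurable f ->
  bounded_measurable (fun x => f (phi x)).
Proof.
move=> mphi [mf [M fM]]; split; last by exists M.
exact: measurableT_comp.
Qed.

Section Mean.
Context {d} {T : measurableType d} {R : realType} (mu : probability T R).
Implicit Types f g : T -> R.

Lemma bounded_measurable_integrable f :
  bounded_measurable f -> mu.-integrable setT (EFin \o f).
Proof.
move=> [mf [M fM]]; apply: measurable_bounded_integrable => //.
  by rewrite (le_lt_trans (probability_le1 mu measurableT))// ltry.
by exists M; split=> [|N MN x _]; [exact: num_real|exact: le_trans (fM x) (ltW MN)].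
Qed.
Hint Resolve bounded_measurable_integrable : core.

Lemma EFin_mean f : bounded_measurable f ->
  (\int[mu]_x f x)%:E = (\int[mu]_x (f x)%:E)%E.
Proof.
move=> mf; rewrite /Rintegral fineK//.
by apply: integrable_fin_num => //; exact: bounded_measurable_integrable.
Qed.

Lemma mean_cst (c : R) : \int[mu]_x c = c.
Proof. by rewrite Rintegral_cst// [X in fine X](probability_setT mu) mulr1. Qed.

Lemma eq_mean f g : (forall x, f x = g x) -> \int[mu]_x f x = \int[mu]_x g x.
Proof. by move=> fg; apply: eq_Rintegral => x _. Qed.

Lemma meanD f g : bounded_measurable f -> bounded_measurable g ->
  \int[mu]_x (f x + g x) = \int[mu]_x f x + \int[mu]_x g x.
Proof. by move=> mf mg; apply: RintegralD => //; auto. Qed.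

Lemma meanB f g : bounded_measurable f -> bounded_measurable g ->
  \int[mu]_x (f x - g x) = \int[mu]_x f x - \int[mu]_x g x.
Proof. by move=> mf mg; apply: RintegralB => //; auto. Qed.

Lemma meanZ (c : R) f : bounded_measurable f ->
  \int[mu]_x (c * f x) = c * \int[mu]_x f x.
Proof. by move=> mf; apply: RintegralZl => //; auto. Qed.

Lemma meanZr (c : R) f : bounded_measurable f ->
  \int[mu]_x (f x * c) = (\int[mu]_x f x) * c.
Proof. by move=> mf; apply: RintegralZr => //; auto. Qed.

Lemma mean_sum I (r : seq I) (P : pred I) (f : I -> T -> R) :
  (forall i, bounded_measurable (f i)) ->
  \int[mu]_x (\sum_(i <- r | P i) f i x) = \sum_(i <- r | P i) \int[mu]_x f i x.
Proof.
move=> mf; elim: r => [|i r IH].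
  by under eq_mean do rewrite big_nil; rewrite big_nil mean_cst.
under eq_mean do rewrite big_cons; rewrite big_cons.
case: (P i) => //; rewrite meanD ?IH//.
exact: bounded_measurable_sum.
Qed.

Lemma le_mean f g : bounded_measurable f -> bounded_measurable g ->
  (forall x, f x <= g x) -> \int[mu]_x f x <= \int[mu]_x g x.
Proof. by move=> mf mg fg; apply: le_Rintegral => //; auto. Qed.

Lemma normr_mean f : bounded_measurable f ->
  `|\int[mu]_x f x| <= \int[mu]_x `|f x|.
Proof. by move=> mf; apply: le_normr_Rintegral => //; auto. Qed.

Lemma mean_indic (A : set T) : measurable A -> \int[mu]_x \1_A x = fine (mu A).
Proof. by move=> mA; rewrite /Rintegral integral_indic// setIT. Qed.

Lemma ae_eq_mean f g : bounded_measurable f -> bounded_measurable g ->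
  {ae mu, forall x, f x = g x} -> \int[mu]_x f x = \int[mu]_x g x.
Proof.
move=> [mf _] [mg _] fg; congr fine; apply: ae_eq_integral => //.
- exact/measurable_EFinP.
- exact/measurable_EFinP.
- by apply: filterS fg => x fgx _ /=; rewrite fgx.
Qed.

Lemma mean_eq0 f : bounded_measurable f -> (forall x, 0 <= f x) ->
  \int[mu]_x f x = 0 -> {ae mu, forall x, f x = 0}.
Proof.
move=> mf f0 If0.
have mfE : measurable_fun setT (EFin \o f) by apply/measurable_EFinP; case: mf.
have : (\int[mu]_x `|(EFin \o f) x| = 0)%E.
  under eq_integral do rewrite /= ger0_norm//.
  by rewrite -EFin_mean// If0.
move/ae_eq_integral_abs => /(_ measurableT mfE).
by apply: filterS => x /(_ I)/= [].
Qed.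

End Mean.
#[global] Hint Resolve bounded_measurable_integrable : core.

Section Fubini.
Context {d1 d2} {T1 : measurableType d1} {T2 : measurableType d2} {R : realType}.
Variables (m1 : probability T1 R) (m2 : probability T2 R) (F : T1 * T2 -> R).
Hypothesis mF : bounded_measurable F.

Lemma bounded_measurable_section1 x : bounded_measurable (fun y => F (x, y)).
Proof. by apply: (bounded_measurable_comp _ mF); exact: pair1_measurable. Qed.

Lemma bounded_measurable_section2 y : bounded_measurable (fun x => F (x, y)).
Proof. by apply: (bounded_measurable_comp _ mF); exact: pair2_measurable. Qed.

Lemma bounded_measurable_mean :
  bounded_measurable (fun x => \int[m2]_y F (x, y)).
Proof.
split.
  apply/measurable_EFinP.
  have /= := @measurable_fubini_F _ _ _ _ _ m1 m2 _ (bounded_measurable_integrable (m1 \x m2)%E mF).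
  apply: eq_measurable_fun => x _; rewrite /fubini_F/=.
  by rewrite EFin_mean//; exact: bounded_measurable_section1.
have [_ [M FM]] := mF; exists M => x.
have mFx := bounded_measurable_section1 x.
apply: le_trans (normr_mean _ mFx) _; rewrite -[leRHS](mean_cst m2).
apply: le_mean => //; last exact: bounded_measurable_cst.
split; first by apply: measurableT_comp => //; case: mFx.
by exists M => y; rewrite normr_id.
Qed.

Lemma mean_prod :
  \int[(m1 \x m2)%E]_z F z = \int[m1]_x \int[m2]_y F (x, y).
Proof.
rewrite /Rintegral -(integral12_prod_meas1 (bounded_measurable_integrable (m1 \x m2)%E mF)).
congr fine; apply: eq_integral => x _; rewrite /fubini_F/= -EFin_mean//.
exact: bounded_measurable_section1.
Qed.

End Fubini.

Lemma mean_swap {d1 d2} {T1 : measurableType d1} {T2 : measurableType d2}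
    {R : realType} (m1 : probability T1 R) (m2 : probability T2 R)
    (F : T1 * T2 -> R) : bounded_measurable F ->
  \int[m1]_x \int[m2]_y F (x, y) = \int[m2]_y \int[m1]_x F (x, y).
Proof.
move=> mF.
rewrite -(mean_prod m1 m2 mF) /Rintegral.
rewrite -(integral21_prod_meas1 (bounded_measurable_integrable (m1 \x m2)%E mF)).
congr fine; apply: eq_integral => y _; rewrite /fubini_G/= -EFin_mean//.
exact: bounded_measurable_section2.
Qed.

Lemma mean_law {d d'} {T : measurableType d} {S : measurableType d'}
    {R : realType} (P : probability T R) (mu : probability S R) (Y : T -> S)
    (f : S -> R) :
  measurable_fun setT Y ->
  (forall C, measurable C -> P (Y @^-1` C) = mu C) ->
  bounded_measurable f ->
  \int[P]_w f (Y w) = \int[mu]_s f s.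
Proof.
move=> mY YE mf; rewrite /Rintegral; congr fine.
pose Ym := mfun_Sub (mem_set mY : Y \in mfun).
transitivity (\int[pushforward P Ym]_s (f s)%:E)%E.
  rewrite integral_pushforward//=.
  - by apply/measurable_EFinP; case: mf.
  - rewrite preimage_setT.
    have mfY : bounded_measurable (fun w => f (Y w)) by exact: bounded_measurable_comp.
    exact: (bounded_measurable_integrable P mfY).
by apply: eq_measure_integral => A mA _; exact: YE.
Qed.

(** * Joint laws of independent variables *)
Section Independence.
Context {d} {T : measurableType d} {R : realType} (P : probability T R).
Context {I : finType} (Z : I -> {RV P >-> R}) (mu : probability R R).

Definition cylinder (ks : {set I}) (B : I -> set R) : set T :=
  \bigcap_(k in [set` ks]) (Z k @^-1` B k).

Lemma measurable_cylinder (ks : {set I}) (B : I -> set R) :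
  (forall k, measurable (B k)) -> measurable (cylinder ks B).
Proof.
move=> mB; apply: fin_bigcap_measurable; first exact: finite_finset.
by move=> k _; rewrite -[X in measurable X]setTI; exact: measurable_funPT.
Qed.

(** [Y] has law [nu], the [Z k] with [k] in [ks] have law [mu], and all of them are
    jointly independent. The set [ks] holds the variables that remain to be
    adjoined to [Y], one at a time. *)
Definition joint_law {d'} {S : measurableType d'} (Y : T -> S)
    (nu : probability S R) (ks : {set I}) : Prop :=
  measurable_fun setT Y /\
  forall C (B : I -> set R), measurable C -> (forall k, measurable (B k)) ->
  P (Y @^-1` C `&` cylinder ks B) = (nu C * \prod_(k in ks) mu (B k))%E.

Lemma cylinder_setU1 k (ks : {set I}) A (B : I -> set R) : k \notin ks ->
  cylinder (k |: ks) (fun j => if j == k then A else B j) =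
  Z k @^-1` A `&` cylinder ks B.
Proof.
move=> kks; apply/seteqP; split=> w.
  move=> H; split; first by have := H k; rewrite /= in_setU1 eqxx; apply.
  move=> j jks; have := H j; rewrite /= in_setU1.
  rewrite (_ : (j == k) = false); first by apply; rewrite orFb; exact: jks.
  by apply: contraNF kks => /eqP <-.
move=> [Zk H] j /=; rewrite in_setU1; case: eqVneq => [->//|jk] jks.
exact: H.
Qed.

Lemma prod_setU1 k (ks : {set I}) A (B : I -> set R) : k \notin ks ->
  (\prod_(j in k |: ks) mu (if j == k then A else B j) =
  mu A * \prod_(j in ks) mu (B j))%E.
Proof.
move=> kks; rewrite big_setU1//= eqxx; congr (_ * _)%E.
apply: eq_bigr => j jks; rewrite (_ : (j == k) = false)//.
by apply: contraNF kks => /eqP <-.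
Qed.

Lemma joint_law_start (D : {set I}) k (ks : {set I}) :
  mutually_independent D Z ->
  (forall j, j \in D -> forall B, measurable B -> P (Z j @^-1` B) = mu B) ->
  k |: ks \subset D -> k \notin ks -> joint_law (Z k) mu ks.
Proof.
move=> ind lawZ ksD kks; split; first exact: measurable_funPT.
move=> C B mC mB; rewrite -(cylinder_setU1 _ _ kks) -(prod_setU1 _ _ kks).
rewrite /cylinder ind//; last by move=> j; case: ifP.
by apply: eq_bigr => j jks; apply: lawZ; [exact: (fintype.subsetP ksD)|case: ifP].
Qed.

(** For fixed events on the remaining variables, of joint probability [c], the
    two sides are measures of [C] that agree on rectangles. Uniqueness of the
    product measure applies after division by [c]; if [c = 0], both sides are 0. *)
Lemma joint_law_cons {d'} {S : measurableType d'} (Y : T -> S)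
    (nu : probability S R) k (ks : {set I}) :
  k \notin ks -> joint_law Y nu (k |: ks) ->
  joint_law (fun w => (Y w, Z k w)) (nu \x mu)%E ks.
Proof.
move=> kks [mY YE]; split; first exact: measurable_fun_pair.
move=> C B mC mB.
have mE := measurable_cylinder ks mB.
have mYZ : measurable_fun setT (fun w => (Y w, Z k w)) by exact: measurable_fun_pair.
pose E := cylinder ks B.
have rect A1 A2 : measurable A1 -> measurable A2 ->
    P ((fun w => (Y w, Z k w)) @^-1` (A1 `*` A2) `&` E) =
    (nu A1 * mu A2 * \prod_(j in ks) mu (B j))%E.
  move=> mA1 mA2; rewrite -muleA -(prod_setU1 _ _ kks) -YE//; last by move=> j; case: ifP.
  by rewrite (cylinder_setU1 _ _ kks) setIA.
have [c [c0 cE]] : exists c : R, 0 <= c /\ (\prod_(j in ks) mu (B j) = c%:E)%E.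
  exists (\prod_(j in ks) fine (mu (B j))); split.
    by apply: prodr_ge0 => j _; exact: fine_ge0.
  rewrite -prodEFin; apply: eq_bigr => j _; rewrite fineK//.
  exact: fin_num_measure.
rewrite cE; rewrite cE in rect.
move: c0; rewrite le_eqVlt => /predU1P[c0|c0].
  rewrite -c0 mule0; apply/eqP; rewrite -measure_le0.
  have : P ((fun w => (Y w, Z k w)) @^-1` (setT `*` setT) `&` E) = 0%E.
    by rewrite rect// -c0 mule0.
  move=> <-; apply: le_measure; rewrite ?inE.
  - by apply: measurableI => //; rewrite -[X in measurable X]setTI; exact: mYZ.
  - by apply: measurableI => //; rewrite -[X in measurable X]setTI; apply: mYZ => //; exact: measurableX.
  - by move=> w [_ ?].
(* the scaled measure to which uniqueness of the product applies *)
have ci0 : 0 <= c^-1 by rewrite invr_ge0 ltW.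
have [m0 m0E] : exists m0 : {measure set (S * R) -> \bar R}, forall A,
    m0 A = P ((fun w => (Y w, Z k w)) @^-1` A `&` E).
  by unshelve eexists (pushforward (mrestr P mE) (fun w => (Y w, Z k w))).
pose m' := mscale (NngNum ci0) m0.
have m'E A : m' A = (c^-1%:E * P ((fun w => (Y w, Z k w)) @^-1` A `&` E))%E.
  by rewrite -m0E.
transitivity (m' C * c%:E)%E.
  by rewrite m'E muleAC -EFinM mulVf ?mul1e// gt_eqF.
congr (_ * _)%E; apply/esym; apply: product_measure_unique mC.
move=> A1 A2 mA1 mA2; rewrite [LHS]m'E rect// muleC -muleA -EFinM mulfV ?mule1//.
by rewrite gt_eqF.
Qed.

Lemma joint_law_end {d'} {S : measurableType d'} (Y : T -> S)
    (nu : probability S R) (f : S -> R) :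
  joint_law Y nu finset.set0 -> bounded_measurable f ->
  \int[P]_w f (Y w) = \int[nu]_s f s.
Proof.
move=> [mY YE] mf; apply: mean_law => // C mC.
have := YE C (fun=> setT) mC (fun=> measurableT).
rewrite big_set0 mule1 => <-; congr (P _).
by rewrite /cylinder (_ : [set` _] = set0) ?bigcap_set0 ?setIT// -subset0 => x /=; rewrite inE.
Qed.

End Independence.

(** * Edge probabilities in the W-random graph *)
Section UnitLaw.
Context {R : realType}.

Let idR : measurableTypeR R -> R := id.

Let measurable_idR : measurable_fun [set: measurableTypeR R] idR.
Proof. by move=> _ A mA; rewrite setTI. Qed.

HB.instance Definition _ := isMeasurableFun.Build _ _ _ _ idR measurable_idR.

(** [uniform_prob] lives on a copy of the real line that carries another measurable
    structure with the same measurable sets; the law is transported to [R] along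
    the identity. *)
Definition unit_law : probability R R :=
  distribution (uniform_prob (@ltr01 R) : probability (measurableTypeR R) R) idR.

Lemma unit_lawE (A : set R) : unit_law A = uniform_prob (@ltr01 R) A.
Proof. by []. Qed.

Lemma unit_law_lebesgue (A : set R) : measurable A ->
  unit_law A = lebesgue_measure (A `&` `[0, 1]%classic).
Proof.
move=> mA; rewrite unit_lawE /uniform_prob integral_uniform_pdf.
rewrite (eq_integral (fun=> 1%E)); last first.
  move=> x; rewrite inE => -[_ /=]; rewrite in_itv/= /uniform_pdf => ->.
  by rewrite subr0 invr1.
by rewrite integral_cst/= ?mul1e//; exact: measurableI.
Qed.

End UnitLaw.

Lemma mean_unit_law_ler {R : realType} (c : R) : 0 <= c <= 1 ->
  \int[unit_law]_u (u <= c)%R%:R = c.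
Proof.
move=> /andP[c0 c1].
have -> : (fun u : R => (u <= c)%R%:R) = \1_(`]-oo, c]%classic) :> (R -> R).
  by apply/funext => u; rewrite indicE mem_setE in_itv/=.
rewrite mean_indic// unit_law_lebesgue// (_ : _ `&` _ = `[0, c]%classic); last first.
  apply/seteqP; split=> u /=; rewrite !in_itv/=; first by move=> [-> /andP[-> _]].
  by move=> /andP[u0 uc]; rewrite uc u0 (le_trans uc c1).
rewrite /= lebesgue_measure_itv/= lte_fin; case: ltP => [_|c0'] /=; first by rewrite subr0.
by apply/eqP; rewrite eq_le c0 c0'.
Qed.

Section Thresholds.
Context {d} {T : measurableType d} {R : realType} (P : probability T R).
Context {I : finType} (Z : I -> {RV P >-> R}).
Notation mu := (@unit_law R).

(** Conditionally on [s], an independent uniform variable is below [c s] with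
    probability [c s]. *)
Lemma mean_threshold {d'} {S : measurableType d'} (nu : probability S R)
    (H c : S -> R) :
  bounded_measurable H -> measurable_fun setT c -> (forall s, 0 <= c s <= 1) ->
  \int[(nu \x mu)%E]_z (H z.1 * (z.2 <= c z.1)%R%:R) = \int[nu]_s (H s * c s).
Proof.
move=> mH mc c01.
have mf : bounded_measurable (fun z : S * R => H z.1 * (z.2 <= c z.1)%R%:R).
  apply: bounded_measurableM; first exact: (bounded_measurable_comp _ mH).
  by apply: bounded_measurable_ler => //; exact: measurableT_comp.
rewrite (mean_prod nu mu mf); apply: eq_mean => s /=.
rewrite meanZ ?mean_unit_law_ler//.
by apply: bounded_measurable_ler => //; exact: measurable_cst.
Qed.

Lemma bounded_measurable_prod_In {d'} {S : measurableType d'}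
    (es : seq (I * (S -> R))) :
  (forall e, List.In e es -> measurable_fun setT e.2 /\ forall s, 0 <= e.2 s <= 1) ->
  bounded_measurable (fun s => \prod_(e <- es) e.2 s).
Proof.
elim: es => [_|e es IH ces].
  by under eq_fun do rewrite big_nil; exact: bounded_measurable_cst.
under eq_fun do rewrite big_cons.
have [me e01] := ces _ (or_introl erefl).
apply: bounded_measurableM; last by apply: IH => e' ?; apply: ces; right.
split=> //; exists 1 => x; have /andP[e0 e1] := e01 x.
by rewrite ger0_norm.
Qed.

(** Induction on the list of thresholds: the first variable is adjoined to [Y], the
    others are handled by the induction hypothesis on the enlarged space, and the
    adjoined variable is integrated out by [mean_threshold]. *)
Lemma mean_thresholds {d'} {S : measurableType d'} (Y : T -> S)
    (nu : probability S R) (H : S -> R) (es : seq (I * (S -> R))) :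
  uniq [seq e.1 | e <- es] ->
  joint_law Z mu Y nu [set k in [seq e.1 | e <- es]]%SET ->
  bounded_measurable H ->
  (forall e, List.In e es -> measurable_fun setT e.2 /\ forall s, 0 <= e.2 s <= 1) ->
  \int[P]_w (H (Y w) * \prod_(e <- es) (Z e.1 w <= e.2 (Y w))%R%:R) =
  \int[nu]_s (H s * \prod_(e <- es) e.2 s).
Proof.
move: {2}(size es) (erefl (size es)) => n.
elim: n d' S Y nu H es => [|n IH] d' S Y nu H [|[k c] es]//=.
  move=> _ _ law mH _; under eq_mean do rewrite big_nil mulr1.
  under [RHS]eq_mean do rewrite big_nil mulr1.
  apply: (joint_law_end (mu := mu) (Z := Z)) mH.
  by rewrite (_ : finset.set0 = [set k in [::]]%SET)//; apply/setP => k; rewrite !inE.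
move=> [sn] /andP[kes ues] law mH ces.
have [mc c01] := ces (k, c) (or_introl erefl).
have law' : joint_law Z mu (fun w => (Y w, Z k w)) (nu \x mu)%E
    [set k in [seq e.1 | e <- es]]%SET.
  apply: joint_law_cons; first by rewrite inE.
  by move: law; congr joint_law; apply/setP => j; rewrite !inE.
pose lift (e : I * (S -> R)) : I * (S * R -> R) := (e.1, fun z : S * R => e.2 z.1).
have mH' : bounded_measurable (fun z : S * R => H z.1 * (z.2 <= c z.1)%R%:R).
  apply: bounded_measurableM; first exact: (bounded_measurable_comp _ mH).
  by apply: bounded_measurable_ler => //; exact: measurableT_comp.
have := IH _ _ _ _ (fun z : S * R => H z.1 * (z.2 <= c z.1)%R%:R) [seq lift e | e <- es].
rewrite size_map -map_comp => /(_ _ _ sn ues law' mH').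
rewrite /= => IH'.
under eq_mean do rewrite big_cons mulrA.
under [RHS]eq_mean do rewrite big_cons mulrA.
have mes : bounded_measurable (fun s => \prod_(e <- es) e.2 s).
  by apply: bounded_measurable_prod_In => e ?; apply: ces; right.
transitivity (\int[(nu \x mu)%E]_z (H z.1 * (z.2 <= c z.1)%R%:R *
    \prod_(e <- [seq lift e | e <- es]) e.2 z)).
  rewrite -IH'.
    by apply: eq_mean => w; rewrite big_map.
  move=> e /List.in_map_iff[e' [<- e'es]].
  have [me e01] := ces _ (or_intror e'es); split => //=.
  exact: measurableT_comp.
transitivity (\int[(nu \x mu)%E]_z ((H z.1 * \prod_(e <- es) e.2 z.1) * (z.2 <= c z.1)%R%:R)).
  by apply: eq_mean => z; rewrite big_map mulrAC.
rewrite (mean_threshold nu (H := fun s => H s * \prod_(e <- es) e.2 s))//; last first.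
  exact: bounded_measurableM.
by apply: eq_mean => s; rewrite mulrAC.
Qed.
End Thresholds.

Section RandomGraph.
Context {d} {T : measurableType d} {R : realType} (P : probability T R).
Context (n : nat) (X : 'I_n -> {RV P >-> R}) (U : 'I_n -> 'I_n -> {RV P >-> R}).
Context (G : R * R -> R).
Hypothesis iid : iid_uniform X U.
Hypothesis mG : measurable_fun setT G.
Hypothesis symG : forall x y, G (x, y) = G (y, x).
Hypothesis G01 : forall z, 0 <= G z <= 1.
Notation mu := (@unit_law R).
Notation mu4 := (((mu \x mu) \x mu) \x mu)%E.
Notation Z := (joint_family X U).

Definition adj (w : T) (i j : 'I_n) : R :=
  (W_graph G (fun i => X i w) (fun i j => U i j w) i j)%:R.

Definition edge (i j : 'I_n) : 'I_n * 'I_n := if (i < j)%N then (i, j) else (j, i).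

Lemma edge_lt i j : i != j -> ((edge i j).1 < (edge i j).2)%N.
Proof. by rewrite /edge neq_ltn; case: ltngtP. Qed.

Lemma edge_eq i j k l :
  (edge i j == edge k l) = ((i == k) && (j == l)) || ((i == l) && (j == k)).
Proof.
rewrite /edge; case: ltngtP => ij; case: ltngtP => kl; rewrite xpair_eqE -!val_eqE /=;
  by apply/idP/idP; lia.
Qed.

Lemma adj_edge w i j : i != j ->
  adj w i j = (Z (inr (edge i j)) w <= G (X i w, X j w))%R%:R.
Proof.
rewrite /adj /W_graph /edge neq_ltn; case: ltngtP => //= ij _; first by rewrite orbF.
by rewrite symG.
Qed.

(** Only the edge variables [U a b] with [a < b] are known to be independent, hence
    the condition on [K]. *)
Lemma joint_law_vertices i j k l (K : {set 'I_n * 'I_n}) :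
  uniq [:: i; j; k; l] -> (forall e, e \in K -> (e.1 < e.2)%N) ->
  joint_law Z mu (fun w => (X i w, X j w, X k w, X l w)) mu4
    [set inr e | e in K]%SET.
Proof.
rewrite /= !inE !negb_or andbT => /and3P[/and3P[ij ik il] /andP[jk jl] kl] Klt.
have [ind law] := iid.
have inl_notin a : inl a \notin [set inr e | e in K]%SET.
  by apply/negP => /imsetP[].
have iE a b : (inl a == inl b :> 'I_n + 'I_n * 'I_n) = (a == b) by [].
have start : joint_law Z mu (X i) mu
    (inl j |: (inl k |: (inl l |: [set inr e | e in K])))%SET.
  apply: (@joint_law_start _ _ _ P _ Z mu (joint_index n) (inl i)) => //.
  - apply/fintype.subsetP => h; rewrite !inE.
    case/orP => [/eqP->//|].
    by case/or4P => [/eqP->|/eqP->|/eqP->|/imsetP[e eK ->]]//; exact: Klt.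
  - by rewrite !inE !iE !negb_or ij ik il inl_notin.
apply: (@joint_law_cons _ _ _ P _ Z mu _ _ _ _ (inl l)); first exact: inl_notin.
apply: (@joint_law_cons _ _ _ P _ Z mu _ _ _ _ (inl k)).
  by rewrite !inE !iE !negb_or kl inl_notin.
apply: (@joint_law_cons _ _ _ P _ Z mu _ _ _ _ (inl j)).
  by rewrite !inE !iE !negb_or jk jl inl_notin.
exact: start.
Qed.

Lemma measurable_edge4 (a b : R * R * R * R -> R) :
  measurable_fun setT a -> measurable_fun setT b ->
  measurable_fun setT (fun s => G (a s, b s)).
Proof. by move=> ma mb; apply: measurableT_comp => //; exact: measurable_fun_pair. Qed.

Lemma mean_edges i j k l (es : seq (('I_n * 'I_n) * (R * R * R * R -> R))) :
  uniq [:: i; j; k; l] -> uniq [seq e.1 | e <- es] ->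
  (forall e, e \in [seq e.1 | e <- es] -> (e.1 < e.2)%N) ->
  (forall e, List.In e es -> measurable_fun setT e.2 /\ forall s, 0 <= e.2 s <= 1) ->
  \int[P]_w (\prod_(e <- es)
    (Z (inr e.1) w <= e.2 (X i w, X j w, X k w, X l w))%R%:R) =
  \int[mu4]_s \prod_(e <- es) e.2 s.
Proof.
move=> uV uE Elt ces.
pose es' := [seq (inr e.1 : 'I_n + 'I_n * 'I_n, e.2) | e <- es].
have keys : [seq e.1 | e <- es'] = [seq inr e | e <- [seq e.1 | e <- es]].
  by rewrite -!map_comp.
pose Y w := (X i w, X j w, X k w, X l w).
transitivity (\int[P]_w (1 * \prod_(e <- es') (Z e.1 w <= e.2 (Y w))%R%:R)).
  by apply: eq_mean => w; rewrite mul1r big_map.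
transitivity (\int[mu4]_s (1 * \prod_(e <- es') e.2 s)); last first.
  by apply: eq_mean => w; rewrite mul1r big_map.
apply: mean_thresholds.
- by rewrite keys map_inj_uniq// => ? ? [].
- rewrite (_ : [set k in _]%SET = [set inr e | e in [set e in [seq e.1 | e <- es]]%SET]%SET).
    by apply: joint_law_vertices => // e; rewrite inE; exact: Elt.
  apply/setP => h; rewrite inE keys; apply/mapP/imsetP => -[e]; rewrite ?inE => eK ->.
    by exists e; rewrite ?inE.
  by exists e.
- exact: bounded_measurable_cst.
- move=> e /List.in_map_iff[e' [<- e'es]]; exact: ces.
Qed.

Let m1 : measurable_fun setT (fun s : R * R * R * R => s.1.1.1).
Proof. by apply: measurableT_comp => //; apply: measurableT_comp. Qed.
Let m2 : measurable_fun setT (fun s : R * R * R * R => s.1.1.2).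
Proof. by apply: measurableT_comp => //; apply: measurableT_comp. Qed.
Let m3 : measurable_fun setT (fun s : R * R * R * R => s.1.2).
Proof. by apply: measurableT_comp. Qed.
Let m4 : measurable_fun setT (fun s : R * R * R * R => s.2).
Proof. exact: measurable_snd. Qed.

Definition cycle4_density : R :=
  \int[mu4]_s (G (s.1.1.1, s.1.1.2) * G (s.1.1.2, s.1.2) *
               G (s.1.2, s.2) * G (s.2, s.1.1.1)).

(** The symmetry of [G] lets the cycle visit its vertices in any order, whatever
    the orientation in which each edge variable is indexed. *)
Lemma mean_cycle4 i j k l : uniq [:: i; j; k; l] ->
  \int[P]_w (adj w i j * adj w j k * adj w k l * adj w l i) = cycle4_density.
Proof.
move=> Hu; have := Hu.
rewrite /= !inE !negb_or andbT => /and3P[/and3P[ij ik il] /andP[jk jl] kl].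
have li : l != i by rewrite eq_sym.
pose es : seq (('I_n * 'I_n) * (R * R * R * R -> R)) :=
  [:: (edge i j, fun s => G (s.1.1.1, s.1.1.2));
      (edge j k, fun s => G (s.1.1.2, s.1.2));
      (edge k l, fun s => G (s.1.2, s.2));
      (edge l i, fun s => G (s.2, s.1.1.1))].
transitivity (\int[P]_w (\prod_(e <- es)
    (Z (inr e.1) w <= e.2 (X i w, X j w, X k w, X l w))%R%:R)).
  by apply: eq_mean => w; rewrite !big_cons big_nil mulr1 !mulrA !adj_edge.
transitivity (\int[mu4]_s \prod_(e <- es) e.2 s); last first.
  by apply: eq_mean => w; rewrite !big_cons big_nil mulr1 !mulrA.
apply: (@mean_edges i j k l es Hu).
- rewrite /= !inE !edge_eq !negb_or !negb_and.
  by rewrite ?(eq_sym j i) ?(eq_sym k i) ?(eq_sym l i) ?(eq_sym k j) ?(eq_sym l j) ?(eq_sym l k)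
    ?ij ?ik ?il ?jk ?jl ?kl ?eqxx ?orbT ?andbT.
- by move=> e; rewrite !inE => /or4P[] /eqP ->; exact: edge_lt.
- by move=> e /= [<-|[<-|[<-|[<-|//]]]] /=; split => //; exact: measurable_edge4.
Qed.

Lemma mean_matching i j k l : uniq [:: i; j; k; l] ->
  \int[P]_w (adj w i j * adj w k l) = (\int[(mu \x mu)%E]_z G z) ^+ 2.
Proof.
move=> Hu; have := Hu.
rewrite /= !inE !negb_or andbT => /and3P[/and3P[ij ik il] /andP[jk jl] kl].
pose es : seq (('I_n * 'I_n) * (R * R * R * R -> R)) :=
  [:: (edge i j, fun s => G (s.1.1.1, s.1.1.2));
      (edge k l, fun s => G (s.1.2, s.2))].
transitivity (\int[mu4]_s (G (s.1.1.1, s.1.1.2) * G (s.1.2, s.2))).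
  transitivity (\int[P]_w (\prod_(e <- es)
      (Z (inr e.1) w <= e.2 (X i w, X j w, X k w, X l w))%R%:R)).
    by apply: eq_mean => w; rewrite !big_cons big_nil mulr1 !adj_edge.
  transitivity (\int[mu4]_s \prod_(e <- es) e.2 s); last first.
    by apply: eq_mean => w; rewrite !big_cons big_nil mulr1.
  apply: (@mean_edges i j k l es Hu).
  - rewrite /= !inE !edge_eq !negb_or !negb_and.
    by rewrite ?(eq_sym j i) ?(eq_sym k i) ?(eq_sym l i) ?(eq_sym k j) ?(eq_sym l j) ?(eq_sym l k)
      ?ij ?ik ?il ?jk ?jl ?kl ?eqxx ?orbT ?andbT.
  - by move=> e; rewrite !inE => /orP[] /eqP ->; exact: edge_lt.
  - by move=> e /= [<-|[<-|//]] /=; split => //; exact: measurable_edge4.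
have bG : bounded_measurable G.
  split=> //; exists 1 => z; have /andP[G0 G1] := G01 z.
  by rewrite ger0_norm.
have b4 a b : measurable_fun setT a -> measurable_fun setT b ->
    bounded_measurable (fun s : R * R * R * R => G (a s, b s)).
  by move=> ma mb; apply: (bounded_measurable_comp _ bG); exact: measurable_fun_pair.
have bF : bounded_measurable (fun s : R * R * R * R => G (s.1.1.1, s.1.1.2) * G (s.1.2, s.2)).
  by apply: bounded_measurableM; apply: b4.
have bF' := bounded_measurable_mean (mu \x mu \x mu)%E mu bF.
rewrite (mean_prod _ _ bF) (mean_prod _ _ bF') /=.
transitivity (\int[(mu \x mu)%E]_z (G z * \int[(mu \x mu)%E]_z G z)).
  apply: eq_mean => -[x y] /=.
  rewrite (mean_prod _ _ bG) -(meanZ _ _ (bounded_measurable_mean mu mu bG)).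
  apply: eq_mean => u; apply: meanZ.
  exact: (bounded_measurable_section1 bG).
by rewrite expr2; exact: meanZr.
Qed.

End RandomGraph.

(** * Coefficients of the random determinant *)
Section RandomDeterminant.
Context {d} {T : measurableType d} {R : realType} (P : probability T R).
Context (n : nat) (X : 'I_n -> {RV P >-> R}) (U : 'I_n -> 'I_n -> {RV P >-> R}).
Context (G : R * R -> R).
Hypothesis mG : measurable_fun setT G.

Definition real_adjacency (w : T) : 'M[R]_n := \matrix_(i, j) adj X U G w i j.

Definition real_det (x : R) (w : T) : R :=
  \det (1%:M + x *: (n%:R^-1 *: real_adjacency w)).

Definition det_coef (k : nat) (w : T) : R :=
  n%:R^-1 ^+ k * \sum_(J : {set 'I_n} | #|J| == k) \det (partial_mx (real_adjacency w) J).

Lemma scaled_det_real (x : R) (w : T) :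
  scaled_det (W_adjacency G X U w) x%:C%C = (real_det x w)%:C%C.
Proof.
rewrite /scaled_det /real_det -[RHS]det_map_mx; congr (\det _).
by apply/matrixP => i j; rewrite !mxE rmorphD !rmorphM /= fmorphV !rmorph_nat.
Qed.

Lemma normr_real_adjacency w i j : `|real_adjacency w i j| <= 1.
Proof. by rewrite mxE /adj; case: W_graph; rewrite ?normr1 ?normr0. Qed.

(** The terms with [k > n] vanish; they are there so that the sum always contains
    the five terms that [taylor4] compares with. *)
Lemma real_det_expansion x w : real_det x w = \sum_(k < n + 5) det_coef k w * x ^+ k.
Proof.
rewrite (addnS n 4) /real_det scalerA det_1_add_scale.
rewrite (partition_big (fun J : {set 'I_n} => (inord #|J| : 'I_(n + 4).+1)) predT)//=.
apply: eq_bigr => k _.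
rewrite /det_coef mulrAC -exprMn [_^-1 * _]mulrC mulr_sumr.
have kJ (J : {set 'I_n}) : (inord #|J| == k) = (#|J| == k).
  rewrite -val_eqE /= inordK// ltnS (leq_trans (max_card _))// card_ord.
  by rewrite leq_addr.
under eq_bigl do rewrite kJ.
by apply: eq_bigr => J /eqP ->.
Qed.

Lemma normr_det_coef k w : `|det_coef k w| <= 1.
Proof.
rewrite /det_coef normrM normrX normfV normr_nat.
apply: le_trans (ler_wpM2l _ (normr_sum_det_partial_mx k (normr_real_adjacency w))) _.
  by rewrite exprn_ge0// invr_ge0 ler0n.
rewrite -exprMn; case: (posnP n) => [->|n0].
  by rewrite invr0 mul0r; case: k => [|k]; rewrite ?expr0// exprS mul0r.
by rewrite mulVf ?expr1n// pnatr_eq0 -lt0n.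
Qed.

Lemma bounded_measurable_adj i j : bounded_measurable (fun w => adj X U G w i j).
Proof.
have mle a b : bounded_measurable (fun w => (U a b w <= G (X a w, X b w))%R%:R : R).
  apply: bounded_measurable_ler => //.
  by apply: measurableT_comp => //; exact: measurable_fun_pair.
rewrite /adj /W_graph; case: (ltngtP i j) => /= ij.
- by under eq_fun do rewrite orbF; exact: mle.
- exact: mle.
- exact: bounded_measurable_cst.
Qed.

Lemma bounded_measurable_det_partial_mx (J : {set 'I_n}) :
  bounded_measurable (fun w => \det (partial_mx (real_adjacency w) J)).
Proof.
apply: bounded_measurable_sum => s.
apply: bounded_measurableM; first exact: bounded_measurable_cst.
apply: bounded_measurable_prod => i; under eq_fun do rewrite !mxE.
by case: (i \in J); [exact: bounded_measurable_adj|exact: bounded_measurable_cst].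
Qed.

Lemma bounded_measurable_det_coef k : bounded_measurable (det_coef k).
Proof.
apply: bounded_measurableM; first exact: bounded_measurable_cst.
by apply: bounded_measurable_sum => J; exact: bounded_measurable_det_partial_mx.
Qed.

Lemma bounded_measurable_real_det x : bounded_measurable (real_det x).
Proof.
rewrite (funext (real_det_expansion x)).
apply: bounded_measurable_sum => k; apply: bounded_measurableM.
  exact: bounded_measurable_det_coef.
exact: bounded_measurable_cst.
Qed.

Lemma mean_real_det x :
  \int[P]_w real_det x w = \sum_(k < n + 5) (\int[P]_w det_coef k w) * x ^+ k.
Proof.
under eq_mean do rewrite real_det_expansion.
rewrite mean_sum => [|k]; last first.
  apply: bounded_measurableM (bounded_measurable_cst _).
  exact: bounded_measurable_det_coef.
by apply: eq_bigr => k _; rewrite meanZr//; exact: bounded_measurable_det_coef.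
Qed.

Lemma normr_mean_det_coef k : `|\int[P]_w det_coef k w| <= 1.
Proof.
have mk := bounded_measurable_det_coef k.
apply: le_trans (normr_mean P mk) _; rewrite -[leRHS](mean_cst P).
apply: le_mean; last by move=> w; exact: normr_det_coef.
  split; first by apply: measurableT_comp => //; case: mk.
  by exists 1 => w; rewrite normr_id normr_det_coef.
exact: bounded_measurable_cst.
Qed.

Lemma mean_real_det_taylor4 :
  taylor4 (fun x => \int[P]_w real_det x w) (fun k => \int[P]_w det_coef k w) 2^-1 2.
Proof.
move=> x x2; rewrite mean_real_det.
exact: (@taylor4_polynomial _ n _ normr_mean_det_coef x x2).
Qed.

Hypothesis iid : iid_uniform X U.
Hypothesis symG : forall x y, G (x, y) = G (y, x).
Hypothesis G01 : forall z, 0 <= G z <= 1.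

Lemma adjC w i j : adj X U G w i j = adj X U G w j i.
Proof. by rewrite /adj /W_graph orbC. Qed.

Lemma adjxx w i : adj X U G w i i = 0.
Proof. by rewrite /adj /W_graph ltnn. Qed.

Lemma adj_idem w i j : adj X U G w i j ^+ 2 = adj X U G w i j.
Proof. by rewrite /adj; case: W_graph; rewrite ?expr1n ?expr0n. Qed.

(** Entries are 0 or 1, so the squared products of [det4_symmetric_hollow] are
    indicators of matchings: three matchings of probability p^2 each, and three
    4-cycles of probability t, each with weight -2. *)
Lemma mean_det_partial_mx4 (J : {set 'I_n}) : #|J| = 4%N ->
  \int[P]_w \det (partial_mx (real_adjacency w) J) =
  3 * (\int[(@unit_law R \x @unit_law R)%E]_z G z) ^+ 2 - 6 * cycle4_density G.
Proof.
move=> J4.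
pose f (i : 'I_4) : 'I_n := enum_val (cast_ord (esym J4) i).
have f_inj : injective f by move=> i j /enum_val_inj/cast_ord_inj.
have Jf : J =i codom f.
  move=> i; apply/idP/codomP => [iJ|[l ->]]; last exact: enum_valP.
  exists (cast_ord J4 (enum_rank_in iJ i)).
  by rewrite /f cast_ordK enum_rankK_in.
pose v k : 'I_n := f (inord k).
pose a i j w := adj X U G w (v i) (v j).
have vv i j : (i < 4)%N -> (j < 4)%N -> (v i == v j) = (i == j).
  by move=> i4 j4; rewrite (inj_eq f_inj) -val_eqE /= !inordK.
have ma i j : bounded_measurable (a i j) by exact: bounded_measurable_adj.
transitivity (\int[P]_w (a 0%N 1%N w * a 2%N 3%N w + a 0%N 2%N w * a 1%N 3%N w
         + a 0%N 3%N w * a 1%N 2%N w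
         - 2 * (a 0%N 1%N w * a 1%N 2%N w * a 2%N 3%N w * a 3%N 0%N w
                 + a 0%N 1%N w * a 1%N 3%N w * a 3%N 2%N w * a 2%N 0%N w
                 + a 0%N 2%N w * a 2%N 1%N w * a 1%N 3%N w * a 3%N 0%N w))).
  apply: eq_mean => w; rewrite (det_partial_mx _ f_inj Jf).
  rewrite det4_symmetric_hollow; last 2 first.
  - by move=> i j; rewrite !mxE adjC.
  - by move=> i; rewrite !mxE adjxx.
  by rewrite !mxE !exprMn !adj_idem.
have m2 i j k l : bounded_measurable (fun w => a i j w * a k l w).
  exact: bounded_measurableM.
have m4 i j k l i' j' k' l' :
    bounded_measurable (fun w => a i j w * a k l w * a i' j' w * a k' l' w).
  by do 2!(apply: bounded_measurableM => //).
rewrite meanB; last 2 first.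
- by do 2!(apply: bounded_measurableD => //).
- apply: bounded_measurableM; first exact: bounded_measurable_cst.
  by do 2!(apply: bounded_measurableD => //).
rewrite meanZ; last by do 2!(apply: bounded_measurableD => //).
rewrite !meanD//; try by apply: bounded_measurableD => //.
by rewrite !(mean_matching iid mG symG G01) ?(mean_cycle4 iid mG symG G01)
  /= ?inE ?vv//; ring.
Qed.

Lemma mean_det_coef4 :
  \int[P]_w det_coef 4 w = 'C(n, 4)%:R / n%:R ^+ 4 *
  (3 * (\int[(@unit_law R \x @unit_law R)%E]_z G z) ^+ 2 - 6 * cycle4_density G).
Proof.
have mJ := bounded_measurable_det_partial_mx.
rewrite /det_coef meanZ ?mean_sum//; last exact: bounded_measurable_sum.
rewrite (eq_bigr _ (fun J J4 => mean_det_partial_mx4 (eqP J4))).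
rewrite sumr_const -cardsE card_draws card_ord -[_ *+ 'C(_, _)]mulr_natl.
by rewrite exprVn mulrA [_^-1 * _]mulrC.
Qed.

End RandomDeterminant.

(** * The limit of the coefficient of order four *)

(** Evaluation at a point of the disc is continuous, a singleton being compact. *)
Lemma nbhs_disc_eval {R : realType} (f : disc_functions R) (z : R[i]) (e : R) :
  `|z| < 1 -> 0 < e ->
  nbhs f [set F : disc_functions R | `|f z - F z| < e%:C].
Proof.
move=> z1 e0.
have eC0 : 0 < e%:C by rewrite ltcR.
have fz : compactly_in (unit_disc (R := R) : set (R[i])^o) [set z].
  by split; [move=> _ ->|exact: compact_set1].
have := @fam_nbhs _ (R[i])^o _ [set z] _ f (entourage_ball (R[i])^o (PosNum eC0)) fz.
by apply: filterS => F /(_ z erefl).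
Qed.

Lemma limit_det_real {R : realType} (p x : R) :
  limit_det p x%:C = (real_limit_det p x)%:C.
Proof.
rewrite /limit_det /real_limit_det.
have -> : - (p%:C * x%:C) - p%:C * (1 - p%:C) * x%:C ^+ 2 / 2 =
  (- (p * x) - p * (1 - p) * x ^+ 2 / 2)%:C.
  by rewrite !(rmorphB, rmorphN, rmorphM, fmorphV, rmorphXn, rmorph1, rmorph_nat).
rewrite /cexp /= cos0 sin0 mulr1 mulr0 rmorphM rmorphD rmorphM rmorph1.
by [].
Qed.

Lemma normr_real_complex_lt {R : realType} (x e : R) : (`|x%:C| < e%:C) = (`|x| < e).
Proof. by rewrite normc_def /= expr0n /= addr0 sqrtr_sqr ltcR. Qed.

(** The distance of [f] to [l] is at most [e] off the event [e <= `|l - f|], and at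
    most [M + `|l|] on it. *)
Lemma mean_dist_le {R : realType} {d} {T : measurableType d} (P : probability T R)
    (f : T -> R) (l e M : R) :
  bounded_measurable f -> 0 <= e -> (forall w, `|f w| <= M) ->
  `|\int[P]_w f w - l| <= e + (M + `|l|) * fine (P [set w | e <= `|l - f w|]).
Proof.
move=> mf e0 fM; set B := [set w | _].
have mfl : bounded_measurable (fun w => f w - l).
  exact: bounded_measurableB (bounded_measurable_cst _).
have mlf : bounded_measurable (fun w => `|l - f w|).
  have [mlf [N lfN]] := bounded_measurableB (bounded_measurable_cst l) mf.
  split; first exact: measurableT_comp.
  by exists N => w; rewrite normr_id.
have mB : measurable B.
  rewrite -[X in measurable X]setTI; apply: measurable_fun_le => //.
  by case: mlf.
have -> : \int[P]_w f w - l = \int[P]_w (f w - l).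
  by rewrite meanB ?mean_cst//; exact: bounded_measurable_cst.
apply: le_trans (normr_mean P mfl) _.
rewrite -mean_indic// -[in leRHS](mean_cst P e).
have mI := bounded_measurable_indic (R := R) mB.
rewrite -meanZ// -meanD//; last 2 first.
- exact: bounded_measurable_cst.
- by apply: bounded_measurableM => //; exact: bounded_measurable_cst.
apply: le_mean.
- by under eq_fun do rewrite distrC.
- apply: bounded_measurableD; first exact: bounded_measurable_cst.
  by apply: bounded_measurableM => //; exact: bounded_measurable_cst.
move=> w; rewrite indicE distrC; case: (boolP (w \in B)) => [_|].
  rewrite mulr1 (le_trans (ler_normB _ _))// addrC.
  by rewrite -[leLHS]add0r lerD// lerD2r fM.
by rewrite notin_setE /B /= mulr0 addr0 => /negP; rewrite -ltNge => /ltW.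
Qed.

Section Convergence.
Context {R : realType} (g : R * R -> R) (p : R)
    (d : nat -> measure_display) (T : forall n, measurableType (d n))
    (P : forall n, probability (T n) R)
    (X : forall n, 'I_n -> {RV (P n) >-> R})
    (U : forall n, 'I_n -> 'I_n -> {RV (P n) >-> R}).
Hypothesis mg : measurable_fun setT g.

Lemma normr_real_det_le2 n x w : `|x| <= 2^-1 ->
  `|real_det (@X n) (@U n) g x w| <= 2.
Proof.
move=> x2; rewrite real_det_expansion.
apply: le_trans (ler_norm_sum _ _ _) _.
apply: le_trans (geometric_half_le2 (n + 5) x2); apply: ler_sum => k _.
rewrite normrM normrX ler_piMl ?exprn_ge0//; exact: normr_det_coef.
Qed.

(** In the first case, [mean_dist_le] upgrades convergence in probability to
    convergence of means, as the determinant is bounded by 2. In the second case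
    the determinant is real at a real point, and one takes real parts. *)
Lemma mean_real_det_cvg x : `|x| <= 2^-1 ->
  cvg_in_probability P
    (fun n w => scaled_det (W_adjacency g (@X n) (@U n) w) : disc_functions R)
    (limit_det p : disc_functions R)
  \/
  ((fun z => complex_expectation (P n)
      (fun w => scaled_det (W_adjacency g (@X n) (@U n) w) z)) : disc_functions R)
    @[n --> \oo] --> (limit_det p : disc_functions R) ->
  \int[P n]_w real_det (@X n) (@U n) g x w @[n --> \oo] --> real_limit_det p x.
Proof.
move=> x2.
have x1 : `|x%:C| < 1 :> R[i] by rewrite normr_real_complex_lt; lra.
set l := real_limit_det p x.
case=> cv; apply/cvgrPdist_lt => e e0.
  have e2 : 0 < e / 2 by rewrite divr_gt0.
  have := cv _ (nbhs_disc_eval (limit_det p) x1 e2).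
  have -> : (fun n => P n [set w | ~ [set F : disc_functions R |
        `|limit_det p x%:C - F x%:C| < (e / 2)%:C]
      (scaled_det (W_adjacency g (@X n) (@U n) w))]) =
      (fun n => P n [set w | e / 2 <= `|l - real_det (@X n) (@U n) g x w|]).
    apply/funext => n; congr (P n _); apply/seteqP; split => w /=;
      rewrite scaled_det_real limit_det_real -rmorphB /= normr_real_complex_lt.
      by move/negP; rewrite -leNgt.
    by rewrite leNgt => /negP.
  pose M := 2 + `|l| + 1.
  (* the event is small enough for M times its probability to be below e / 2 *)
  move=> /fine_cvgP[Pfin /cvgrPdist_lt /(_ (e / 2 / M))].
  have M0 : 0 < M by rewrite /M ltr_wpDl// addr_ge0.
  move=> /(_ ltac:(by rewrite divr_gt0)); apply: filterS => n /=.
  rewrite sub0r normrN => Pn.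
  have := @mean_dist_le _ _ _ (P n) _ l (e / 2) 2
    (bounded_measurable_real_det (@X n) (@U n) mg x) (ltW e2)
    (fun w => normr_real_det_le2 w x2).
  rewrite distrC => /le_lt_trans; apply.
  rewrite [ltRHS](_ : e = e / 2 + M * (e / 2 / M)); last by field; rewrite gt_eqF.
  rewrite ltrD2l; apply: le_lt_trans (_ : M * fine (P n [set w | e / 2 <= `|l - real_det (@X n) (@U n) g x w|]) < _).
    by rewrite ler_wpM2r ?fine_ge0// /M lerDl.
  by rewrite ltr_pM2l// (le_lt_trans (ler_norm _)).
have : \forall n \near \oo, `|limit_det p x%:C - complex_expectation (P n)
    (fun w => scaled_det (W_adjacency g (@X n) (@U n) w) x%:C)| < e%:C.
  exact: cv _ (nbhs_disc_eval (limit_det p) x1 e0).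
apply: filterS => n /=.
rewrite limit_det_real /complex_expectation -/l.
have -> : (fun w => complex.Re (scaled_det (W_adjacency g (@X n) (@U n) w) x%:C)) =
    real_det (@X n) (@U n) g x.
  by apply/funext => w; rewrite scaled_det_real.
move=> H; rewrite -normr_real_complex_lt; apply: le_lt_trans H.
apply: le_trans (normc_ge_Re _).
by rewrite /= unlock /Rintegral normc_def /= expr0n /= addr0 sqrtr_sqr.
Qed.

End Convergence.

Lemma cvg_bin4 {R : realType} :
  'C(n, 4)%:R / n%:R ^+ 4 @[n --> \oo] --> (24^-1 : R).
Proof.
have inv0 : (n%:R : R)^-1 @[n --> \oo] --> (0 : R).
  apply: cvg_trans (cvg_harmonic (R := R)).
  rewrite -(cvg_shiftn 1) /=.
  by apply: near_eq_cvg; near=> n; rewrite /harmonic addn1.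
have lin (c : R) : 1 - c * n%:R^-1 @[n --> \oo] --> (1 : R).
  rewrite -[X in _ --> X]subr0 -[X in _ - X](mulr0 c).
  by apply: cvgB; [exact: cvg_cst|apply: cvgM; [exact: cvg_cst|]].
have lim : (1 - 1 * n%:R^-1) * (1 - 2 * n%:R^-1) * (1 - 3 * n%:R^-1) / 24
    @[n --> \oo] --> (24^-1 : R).
  rewrite -[X in _ --> X]mul1r -[X in X / _]mulr1 -[X in X * 1 / _]mulr1.
  by apply: cvgM; [apply: cvgM; [apply: cvgM; exact: lin|exact: lin]|exact: cvg_cst].
apply: cvg_trans lim; apply: near_eq_cvg; near=> n.
have n4 : (4 <= n)%N by near: n; exists 4%N.
have n0 : n%:R != 0 :> R by rewrite pnatr_eq0; lia.
have -> : 'C(n, 4)%:R = (n%:R * (n%:R - 1) * (n%:R - 2) * (n%:R - 3)) / 24 :> R.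
  have : 'C(n, 4)%:R * 24 = n%:R * (n%:R - 1) * (n%:R - 2) * (n%:R - 3) :> R.
    rewrite -(natrM _ _ 24) (bin_ffact n 4) !ffactnS ffactn0 muln1.
    rewrite !natrM -!subn1 -!subnDA !natrB//; try lia.
    by rewrite !mulrA.
  by move=> <-; rewrite mulfK.
by field.
Unshelve. all: by end_near. Qed.

Lemma cvg_fourth_difference {R : realType} (F : nat -> R -> R) (f : R -> R) (h : R) :
  0 <= h -> 2 * h <= 2^-1 ->
  (forall x, `|x| <= 2^-1 -> F n x @[n --> \oo] --> f x) ->
  fourth_difference (F n) h @[n --> \oo] --> fourth_difference f h.
Proof.
move=> h0 h2 cv; rewrite /fourth_difference.
apply: cvgD; last by apply: cv; rewrite normrN ger0_norm//; lra.
apply: cvgB; last first.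
  by apply: cvgM; [exact: cvg_cst|apply: cv; rewrite normrN ger0_norm//; lra].
apply: cvgD; last first.
  by apply: cvgM; [exact: cvg_cst|apply: cv; rewrite normr0; lra].
apply: cvgB; first by apply: cv; rewrite ger0_norm//; lra.
by apply: cvgM; [exact: cvg_cst|apply: cv; rewrite ger0_norm//; lra].
Qed.

(** The fourth difference at scale [h] determines 24 h^4 times the coefficient of
    order 4 up to O(h^5), for [F n] uniformly in [n] and for [f]. Letting first [n]
    tend to infinity and then [h] to 0 identifies the two coefficients. *)
Lemma taylor4_coef_limit {R : realType} (F : nat -> R -> R) (f : R -> R)
    (a : nat -> nat -> R) (b : nat -> R) (rho A B alpha : R) :
  0 < rho <= 2^-1 ->
  (forall n, taylor4 (F n) (a n) 2^-1 A) -> taylor4 f b rho B ->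
  (forall x, `|x| <= 2^-1 -> F n x @[n --> \oo] --> f x) ->
  a n 4%N @[n --> \oo] --> alpha -> alpha = b 4%N.
Proof.
move=> /andP[rho0 rho2] FT fT cv av.
have key h : 0 < h -> 2 * h <= rho -> `|alpha - b 4%N| <= 3 * (A + B) * h.
  move=> h0 hr; have h0' := ltW h0; have h2 : 2 * h <= 2^-1 := le_trans hr rho2.
  have Fd n := fourth_difference_taylor4 h0' h2 (FT n).
  have fd := fourth_difference_taylor4 h0' hr fT.
  have lim : `|fourth_difference f h - 24 * alpha * h ^+ 4| <= 72 * A * h ^+ 5.
    have cvd : `|fourth_difference (F n) h - 24 * a n 4%N * h ^+ 4| @[n --> \oo] -->
        `|fourth_difference f h - 24 * alpha * h ^+ 4|.
      apply: cvg_norm; apply: cvgB; first exact: cvg_fourth_difference.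
      apply: cvgM; last exact: cvg_cst.
      by apply: cvgM => //; exact: cvg_cst.
    rewrite -(cvg_lim _ cvd)//; apply: limr_le; first by apply/cvg_ex; eexists; exact: cvd.
    by near=> n.
  have h4 : 0 < 24 * h ^+ 4 by rewrite mulr_gt0// exprn_gt0.
  rewrite -(ler_pM2l h4).
  have -> : 24 * h ^+ 4 * `|alpha - b 4%N| = `|24 * alpha * h ^+ 4 - 24 * b 4%N * h ^+ 4|.
    by rewrite -[in LHS](gtr0_norm h4) -normrM; congr Num.norm; ring.
  have -> : 24 * h ^+ 4 * (3 * (A + B) * h) = 72 * A * h ^+ 5 + 72 * B * h ^+ 5 by ring.
  rewrite distrC in lim.
  apply: le_trans (lerD lim fd); apply: le_trans (ler_normD _ _).
  by rewrite addrA subrK.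
(* the bound [key] tends to 0 with h *)
apply/eqP; rewrite -subr_eq0 -normr_le0.
have : 3 * (A + B) * h @[h --> 0^'+] --> 3 * (A + B) * 0.
  apply: cvgM; first exact: cvg_cst.
  exact: cvg_at_right_filter (@cvg_id _ _).
rewrite mulr0 => cv0; rewrite -(cvg_lim _ cv0)//.
apply: limr_ge; first by apply/cvg_ex; eexists; exact: cv0.
near=> h; apply: key; first by [].
have : h <= rho / 2 by near: h; apply: nbhs_right_le; rewrite divr_gt0.
by rewrite ler_pdivlMr// mulrC.
Unshelve. all: by end_near. Qed.

(** * Four-cycle density and constancy *)
Section Density.
Context {d} {T : measurableType d} {R : realType} (mu : {measure set T -> \bar R}).
Variable f : T -> \bar R.
Hypothesis mf : measurable_fun setT f.
Hypothesis f0 : forall x, (0 <= f x)%E.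

Definition density_measure (A : set T) : \bar R := (\int[mu]_(x in A) f x)%E.

Let density0 : density_measure set0 = 0%E.
Proof. exact: integral_set0. Qed.

Let density_ge0 A : (0 <= density_measure A)%E.
Proof. by apply: integral_ge0 => x _. Qed.

Let density_sigma_additive : semi_sigma_additive density_measure.
Proof.
move=> F mF tF mUF; rewrite /density_measure; apply: cvg_toP.
  apply: ereal_nondecreasing_is_cvgn => m n mn.
  by apply: lee_sum_nneg_natr => // k _ _; exact: integral_ge0.
rewrite ge0_integral_bigcup//=.
exact: measurable_funTS.
Qed.

HB.instance Definition _ := isMeasure.Build _ _ _ density_measure
  density0 density_ge0 density_sigma_additive.

End Density.

Section ConstantFromRectangles.
Context {d1 d2} {T1 : measurableType d1} {T2 : measurableType d2} {R : realType}.
Variables (m1 : probability T1 R) (m2 : probability T2 R) (G : T1 * T2 -> R) (p : R).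

(** The measure of density [G / p] agrees with the product measure on rectangles,
    hence everywhere. *)
Lemma ae_constant_of_rectangles :
  bounded_measurable G -> (forall z, 0 <= G z) -> 0 < p ->
  (forall A B, measurable A -> measurable B ->
    \int[(m1 \x m2)%E]_z (\1_A z.1 * \1_B z.2 * G z) =
    p * \int[m1]_x \1_A x * \int[m2]_y \1_B y) ->
  {ae (m1 \x m2)%E, forall z, G z = p}.
Proof.
move=> bG G0 p0 rect.
have mGE : measurable_fun setT (EFin \o G) by apply/measurable_EFinP; case: bG.
have GE0 z : (0 <= (EFin \o G) z)%E by rewrite lee_fin.
have pi0 : 0 <= p^-1 by rewrite invr_ge0 ltW.
have [nu nuE] : exists nu : {measure set (T1 * T2) -> \bar R}, forall A,
    nu A = (\int[(m1 \x m2)%E]_(z in A) (EFin \o G) z)%E.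
  by unshelve eexists (density_measure (m1 \x m2)%E (EFin \o G)).
pose nu' := mscale (NngNum pi0) nu.
have nu'E A : nu' A = (p^-1%:E * nu A)%E by [].
have setE C : measurable C -> (\int[(m1 \x m2)%E]_(z in C) (EFin \o G) z)%E =
    (p%:E * (m1 \x m2)%E C)%E.
  move=> mC; rewrite -nuE.
  have -> : (m1 \x m2)%E C = nu' C.
    apply: product_measure_unique mC => A B mA mB.
    rewrite [LHS]nu'E nuE.
    have bI : bounded_measurable (fun z : T1 * T2 => \1_A z.1 * \1_B z.2 * G z : R).
      apply: bounded_measurableM bG; apply: bounded_measurableM.
        by apply: (bounded_measurable_comp _ (bounded_measurable_indic mA)).
      by apply: (bounded_measurable_comp _ (bounded_measurable_indic mB)).
    rewrite integral_mkcond.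
    transitivity (p^-1%:E * \int[(m1 \x m2)%E]_z (\1_A z.1 * \1_B z.2 * G z)%:E)%E.
      congr (_ * _)%E; apply: eq_integral => z _; rewrite patchE !indicE.
      rewrite in_setX; case: (z.1 \in A); case: (z.2 \in B);
        by rewrite /= ?mul0r ?mulr0 ?mul0r ?mul1r.
    rewrite -(EFin_mean (m1 \x m2)%E bI) rect// !mean_indic//.
    rewrite -EFinM !mulrA mulVf ?gt_eqF// mul1r EFinM !fineK//; exact: fin_num_measure.
  by rewrite nu'E muleA -EFinM mulfV ?gt_eqF// mul1e.
have : ae_eq (m1 \x m2)%E setT (EFin \o G) (cst p%:E).
  apply: integral_ae_eq => //.
  - exact: (bounded_measurable_integrable (m1 \x m2)%E bG).
  - move=> C _ mC; rewrite setE//.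
    by rewrite integral_cst.
by apply: filterS => z /(_ I)/= [].
Qed.

End ConstantFromRectangles.

(** A symmetric kernel of density [p] whose 4-cycle density is [p ^+ 4] is constant
    almost everywhere; such kernels are called quasi-random. *)
Section QuasiRandom.
Context {d} {T : measurableType d} {R : realType} (mu : probability T R).
Variables (G : T * T -> R) (p : R).
Hypothesis bG : bounded_measurable G.
Hypothesis symG : forall x y, G (x, y) = G (y, x).
Hypothesis p0 : 0 < p.
Notation mu2 := (mu \x mu)%E.
Notation mu3 := ((mu \x mu) \x mu)%E.
Notation mu4 := (((mu \x mu) \x mu) \x mu)%E.
Hypothesis density : \int[mu2]_z G z = p.

Definition degree (x : T) : R := \int[mu]_y G (x, y).
Definition codegree (z : T * T) : R := \int[mu]_y (G (z.1, y) * G (y, z.2)).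

Lemma bounded_measurable_G {d'} {S : measurableType d'} (a b : S -> T) :
  measurable_fun setT a -> measurable_fun setT b ->
  bounded_measurable (fun s => G (a s, b s)).
Proof.
by move=> ma mb; apply: (bounded_measurable_comp _ bG); exact: measurable_fun_pair.
Qed.

Lemma bounded_measurable_degree : bounded_measurable degree.
Proof. exact: bounded_measurable_mean. Qed.

Lemma bounded_measurable_codegree : bounded_measurable codegree.
Proof.
apply: (@bounded_measurable_mean _ _ _ _ _ mu2 mu (fun s => G (s.1.1, s.2) * G (s.2, s.1.2))).
by apply: bounded_measurableM; apply: bounded_measurable_G => //; exact: measurableT_comp.
Qed.

Lemma codegreeC x y : codegree (x, y) = codegree (y, x).
Proof. by apply: eq_mean => u /=; rewrite mulrC (symG u) (symG x). Qed.

Lemma mean_degree : \int[mu]_x degree x = p.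
Proof. by rewrite -density (mean_prod _ _ bG). Qed.

(** Both sides integrate G(x,y) G(y,z) over all paths of length two; the right
    side groups the paths by their middle vertex. *)
Lemma mean_codegree : \int[mu2]_z codegree z = \int[mu]_x degree x ^+ 2.
Proof.
rewrite (mean_prod _ _ bounded_measurable_codegree) /=.
have bF x : bounded_measurable (fun z : T * T => G (x, z.2) * G (z.2, z.1)).
  by apply: bounded_measurableM; apply: bounded_measurable_G => //; exact: measurable_cst.
transitivity (\int[mu]_x \int[mu]_y (G (x, y) * degree y)).
  apply: eq_mean => x; rewrite (mean_swap mu mu (bF x))/=.
  apply: eq_mean => y; rewrite meanZ//.
  exact: (bounded_measurable_section1 bG).
have bH : bounded_measurable (fun z => G z * degree z.2).
  by apply: bounded_measurableM => //; exact: (bounded_measurable_comp _ bounded_measurable_degree).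
rewrite (mean_swap mu mu bH) /=; apply: eq_mean => y.
rewrite meanZr; last exact: (bounded_measurable_section2 bG).
by rewrite expr2; congr (_ * _); apply: eq_mean => x; rewrite symG.
Qed.

(** A 4-cycle consists of two paths of length two joining the opposite vertices
    1 and 3, so after integration over the vertices 2 and 4 each path contributes
    a codegree. *)
Lemma mean_cycle4_codegree :
  \int[mu4]_s (G (s.1.1.1, s.1.1.2) * G (s.1.1.2, s.1.2) *
               G (s.1.2, s.2) * G (s.2, s.1.1.1)) = \int[mu2]_z codegree z ^+ 2.
Proof.
have m1 : measurable_fun setT (fun s : T * T * T * T => s.1.1.1).
  by apply: measurableT_comp => //; apply: measurableT_comp.
have m2 : measurable_fun setT (fun s : T * T * T * T => s.1.1.2).
  by apply: measurableT_comp => //; apply: measurableT_comp.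
have m3 : measurable_fun setT (fun s : T * T * T * T => s.1.2).
  by apply: measurableT_comp.
have b4 : bounded_measurable (fun s : T * T * T * T =>
    G (s.1.1.1, s.1.1.2) * G (s.1.1.2, s.1.2) * G (s.1.2, s.2) * G (s.2, s.1.1.1)).
  by do !apply: bounded_measurableM; apply: bounded_measurable_G.
have n1 : measurable_fun setT (fun s : T * T * T => s.1.1).
  by apply: measurableT_comp.
have n2 : measurable_fun setT (fun s : T * T * T => s.1.2).
  by apply: measurableT_comp.
have bK (d' : measure_display) (S : measurableType d') (a b : S -> T) : measurable_fun setT a ->
    measurable_fun setT b -> bounded_measurable (fun s => codegree (a s, b s)).
  move=> ma mb; apply: (bounded_measurable_comp _ bounded_measurable_codegree).
  exact: measurable_fun_pair.
have b3 : bounded_measurable (fun s : T * T * T =>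
    G (s.1.1, s.1.2) * G (s.1.2, s.2) * codegree (s.2, s.1.1)).
  apply: bounded_measurableM; last exact: bK.
  by apply: bounded_measurableM; apply: bounded_measurable_G.
transitivity (\int[mu3]_s (G (s.1.1, s.1.2) * G (s.1.2, s.2) * codegree (s.2, s.1.1))).
  rewrite (mean_prod _ _ b4); apply: eq_mean => s /=.
  rewrite /codegree -meanZ; last first.
    by apply: bounded_measurableM; apply: bounded_measurable_G => //; exact: measurable_cst.
  by apply: eq_mean => y /=; rewrite mulrA.
rewrite (mean_prod _ _ b3) (mean_prod _ _ (bounded_measurable_mean mu2 mu b3)) /=.
have bK2 := bounded_measurableX 2 bounded_measurable_codegree.
rewrite (mean_prod _ _ bK2); apply: eq_mean => x /=.
have b2 : bounded_measurable (fun z : T * T =>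
    G (x, z.1) * G (z.1, z.2) * codegree (z.2, x)).
  apply: bounded_measurableM; last by apply: bK => //; exact: measurable_cst.
  by apply: bounded_measurableM; apply: bounded_measurable_G => //; exact: measurable_cst.
rewrite (mean_swap mu mu b2) /=; apply: eq_mean => y.
rewrite meanZr; last first.
  by apply: bounded_measurableM; apply: bounded_measurable_G => //; exact: measurable_cst.
by rewrite codegreeC expr2.
Qed.

Hypothesis cycle4 : \int[mu4]_s (G (s.1.1.1, s.1.1.2) * G (s.1.1.2, s.1.2) *
               G (s.1.2, s.2) * G (s.2, s.1.1.1)) = p ^+ 4.

Lemma variance_degree : \int[mu]_x (degree x - p) ^+ 2 = \int[mu]_x degree x ^+ 2 - p ^+ 2.
Proof.
have bd := bounded_measurable_degree.
have bc c : bounded_measurable (fun=> c : R) := bounded_measurable_cst c.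
transitivity (\int[mu]_x (degree x ^+ 2 - (2 * p * degree x - p ^+ 2))).
  by apply: eq_mean => x; ring.
rewrite meanB; [|exact: bounded_measurableX|]; last first.
  by apply: bounded_measurableB => //; apply: bounded_measurableM.
rewrite meanB//; last by apply: bounded_measurableM.
by rewrite meanZ// mean_degree mean_cst; ring.
Qed.

(** The left side is nonnegative and the right side nonpositive, so both are zero;
    this is where equality in Cauchy-Schwarz is exploited. *)
Lemma variance_codegree :
  \int[mu2]_z (codegree z - p ^+ 2) ^+ 2 =
  - (2 * p ^+ 2 * \int[mu]_x (degree x - p) ^+ 2).
Proof.
have bk := bounded_measurable_codegree.
have bc c : bounded_measurable (fun=> c : R) := bounded_measurable_cst c.
transitivity (\int[mu2]_z (codegree z ^+ 2 - (2 * p ^+ 2 * codegree z - p ^+ 4))).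
  by apply: eq_mean => x; ring.
rewrite meanB; [|exact: bounded_measurableX|]; last first.
  by apply: bounded_measurableB => //; apply: bounded_measurableM.
rewrite meanB//; last by apply: bounded_measurableM.
rewrite meanZ// mean_cst mean_codegree -mean_cycle4_codegree cycle4 variance_degree.
by ring.
Qed.

Let sq_degree_ge0 : 0 <= \int[mu]_x (degree x - p) ^+ 2.
Proof. by apply: Rintegral_ge0 => x _; exact: sqr_ge0. Qed.

Let sq_codegree_ge0 : 0 <= \int[mu2]_z (codegree z - p ^+ 2) ^+ 2.
Proof. by apply: Rintegral_ge0 => x _; exact: sqr_ge0. Qed.

Let p2 : 0 < p ^+ 2. Proof. exact: exprn_gt0. Qed.

Let variance_degree0 : \int[mu]_x (degree x - p) ^+ 2 = 0.
Proof.
apply/eqP; rewrite eq_le sq_degree_ge0 andbT; move: sq_codegree_ge0.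
by rewrite variance_codegree oppr_ge0 pmulr_rle0// mulr_gt0.
Qed.

Lemma ae_degree : {ae mu, forall x, degree x = p}.
Proof.
move/mean_eq0: variance_degree0 => /(_ _ (fun=> sqr_ge0 _)) H.
have {}H := H (bounded_measurableX 2 (bounded_measurableB bounded_measurable_degree (bounded_measurable_cst p))).
by apply: filterS H => x /eqP; rewrite sqrf_eq0 subr_eq0 => /eqP.
Qed.

Lemma ae_codegree : {ae mu2, forall z, codegree z = p ^+ 2}.
Proof.
have : \int[mu2]_z (codegree z - p ^+ 2) ^+ 2 = 0.
  by rewrite variance_codegree variance_degree0 mulr0 oppr0.
move/mean_eq0 => /(_ _ (fun=> sqr_ge0 _)) H.
have {}H := H (bounded_measurableX 2 (bounded_measurableB bounded_measurable_codegree (bounded_measurable_cst (p ^+ 2)))).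
by apply: filterS H => x /eqP; rewrite sqrf_eq0 subr_eq0 => /eqP.
Qed.

(** Expanding the square and integrating over [x] first produces
    K(y,z) - p D(y) - p D(z) + p^2, which is a combination of K - p^2 and D - p and
    hence null almost everywhere. *)
Lemma quadratic_form_eq0 (phi : T -> R) : bounded_measurable phi ->
  \int[mu]_x (\int[mu]_y (phi y * (G (x, y) - p))) ^+ 2 = 0.
Proof.
move=> bphi.
have bc (d' : measure_display) (S : measurableType d') (c : R) :
  @bounded_measurable _ S _ (fun=> c) := bounded_measurable_cst c.
have bphi' (d' : measure_display) (S : measurableType d') (a : S -> T) :
    measurable_fun setT a -> bounded_measurable (fun s => phi (a s)).
  by move=> ma; exact: (bounded_measurable_comp _ bphi).
have bdeg (d' : measure_display) (S : measurableType d') (a : S -> T) :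
    measurable_fun setT a -> bounded_measurable (fun s => degree (a s)).
  by move=> ma; exact: (bounded_measurable_comp _ bounded_measurable_degree).
have bh (d' : measure_display) (S : measurableType d') (a b : S -> T) :
    measurable_fun setT a -> measurable_fun setT b ->
    bounded_measurable (fun s => phi (b s) * (G (a s, b s) - p)).
  move=> ma mb; apply: bounded_measurableM; first exact: bphi'.
  by apply: bounded_measurableB => //; exact: bounded_measurable_G.
have bQ : bounded_measurable (fun s : T * (T * T) =>
    (phi s.2.1 * (G (s.1, s.2.1) - p)) * (phi s.2.2 * (G (s.1, s.2.2) - p))).
  by apply: bounded_measurableM; apply: bh => //; exact: measurableT_comp.
transitivity (\int[mu]_x \int[mu2]_z
    ((phi z.1 * (G (x, z.1) - p)) * (phi z.2 * (G (x, z.2) - p)))).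
  apply: eq_mean => x.
  rewrite (mean_prod mu mu (bounded_measurable_section1 bQ x)) /=.
  have bhx : bounded_measurable (fun y => phi y * (G (x, y) - p)).
    by apply: bh => //; exact: measurable_cst.
  rewrite expr2 -meanZr//; apply: eq_mean => y.
  by rewrite meanZ.
rewrite (mean_swap mu mu2 bQ) /=.
transitivity (\int[mu2]_z (phi z.1 * phi z.2 *
    ((codegree z - p ^+ 2) - p * (degree z.1 - p) - p * (degree z.2 - p)))).
  apply: eq_mean => -[y z] /=.
  have bGy y' : bounded_measurable (fun x => G (x, y')).
    by apply: bounded_measurable_G => //; exact: measurable_cst.
  have bGG : bounded_measurable (fun x => G (y, x) * G (x, z)).
    by apply: bounded_measurableM => //; apply: bounded_measurable_G => //; exact: measurable_cst.
  have degE y' : degree y' = \int[mu]_x G (x, y') by apply: eq_mean => x; rewrite symG.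
  transitivity (\int[mu]_x (phi y * phi z *
      (G (y, x) * G (x, z) - (p * G (x, y) + (p * G (x, z) - p ^+ 2))))).
    by apply: eq_mean => x; rewrite (symG y); ring.
  rewrite meanZ; last first.
    apply: bounded_measurableB => //; apply: bounded_measurableD.
      exact: bounded_measurableM.
    by apply: bounded_measurableB => //; exact: bounded_measurableM.
  rewrite meanB//; last first.
    apply: bounded_measurableD; first exact: bounded_measurableM.
    by apply: bounded_measurableB => //; exact: bounded_measurableM.
  rewrite meanD//; last 2 first.
  - exact: bounded_measurableM.
  - by apply: bounded_measurableB => //; exact: bounded_measurableM.
  rewrite meanB//; last exact: bounded_measurableM.
  by rewrite !meanZ// mean_cst -!degE; congr (_ * _); rewrite /codegree /=; ring.
have bpp : bounded_measurable (fun z : T * T => phi z.1 * phi z.2).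
  by apply: bounded_measurableM; exact: bphi'.
have bK : bounded_measurable (fun z => phi z.1 * phi z.2 * (codegree z - p ^+ 2)).
  apply: bounded_measurableM => //.
  by apply: bounded_measurableB => //; exact: bounded_measurable_codegree.
have bd (a : T * T -> T) : measurable_fun setT a ->
    bounded_measurable (fun z : T * T => phi z.1 * phi z.2 * (p * (degree (a z) - p))).
  move=> ma; apply: bounded_measurableM => //; apply: bounded_measurableM => //.
  by apply: bounded_measurableB => //; exact: bdeg.
transitivity (\int[mu2]_z (phi z.1 * phi z.2 * (codegree z - p ^+ 2)
    - phi z.1 * phi z.2 * (p * (degree z.1 - p))
    - phi z.1 * phi z.2 * (p * (degree z.2 - p)))).
  by apply: eq_mean => z; ring.
rewrite meanB; [|by apply: bounded_measurableB => //; exact: bd|exact: bd].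
rewrite meanB//; last exact: bd.
have -> : \int[mu2]_z (phi z.1 * phi z.2 * (codegree z - p ^+ 2)) = 0.
  rewrite -[RHS](mean_cst mu2); apply: ae_eq_mean => //.
  by apply: filterS ae_codegree => z ->; rewrite subrr mulr0.
have deg0 : \int[mu]_x (phi x * (p * (degree x - p))) = 0.
  rewrite -[RHS](mean_cst mu); apply: ae_eq_mean => //.
    apply: bounded_measurableM => //; apply: bounded_measurableM => //.
    by apply: bounded_measurableB => //; exact: bounded_measurable_degree.
  by apply: filterS ae_degree => z ->; rewrite subrr !mulr0.
have bpd : bounded_measurable (fun x => phi x * (p * (degree x - p))).
  apply: bounded_measurableM => //; apply: bounded_measurableM => //.
  by apply: bounded_measurableB => //; exact: bounded_measurable_degree.
have deg2 : \int[mu2]_z (phi z.1 * phi z.2 * (p * (degree z.2 - p))) = 0.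
  rewrite (mean_prod mu mu (bd snd measurable_snd)) /= -[RHS](mean_cst mu).
  apply: eq_mean => x; under eq_mean do rewrite -mulrA.
  by rewrite meanZ// deg0 mulr0.
have deg1 : \int[mu2]_z (phi z.1 * phi z.2 * (p * (degree z.1 - p))) = 0.
  rewrite (mean_prod mu mu (bd fst measurable_fst)) /=.
  rewrite (mean_swap mu mu (bd fst measurable_fst)) /= -[RHS](mean_cst mu).
  apply: eq_mean => x; under eq_mean do rewrite mulrAC mulrC.
  by rewrite meanZ// deg0 mulr0.
by rewrite deg1 deg2 !subr0.
Qed.

(** Taking for phi the indicator of [B] in [quadratic_form_eq0] shows that
    int_B (G(x,y) - p) dy = 0 for almost every [x]; it remains to integrate over
    [A]. *)
Lemma ae_constant_of_cycle4 : (forall z, 0 <= G z) -> {ae mu2, forall z, G z = p}.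
Proof.
move=> G0; apply: ae_constant_of_rectangles => // A B mA mB.
have bA := bounded_measurable_indic (R := R) mA.
have bB := bounded_measurable_indic (R := R) mB.
have b1 : bounded_measurable (fun z : T * T => \1_A z.1 * \1_B z.2 * G z : R).
  apply: bounded_measurableM => //; apply: bounded_measurableM.
    exact: (bounded_measurable_comp _ bA).
  exact: (bounded_measurable_comp _ bB).
rewrite (mean_prod _ _ b1) /=.
have bv : bounded_measurable (fun x => \int[mu]_y (\1_B y * (G (x, y) - p))).
  apply: (@bounded_measurable_mean _ _ _ _ _ mu mu (fun z => \1_B z.2 * (G z - p))).
  apply: bounded_measurableM; first exact: (bounded_measurable_comp _ bB).
  by apply: bounded_measurableB => //; exact: bounded_measurable_cst.
have v0 : {ae mu, forall x, \int[mu]_y (\1_B y * (G (x, y) - p)) = 0}.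
  have := mean_eq0 (bounded_measurableX 2 bv) (fun=> sqr_ge0 _) (quadratic_form_eq0 bB).
  by apply: filterS => x /eqP; rewrite sqrf_eq0 => /eqP.
rewrite mulrAC -meanZ//.
apply: ae_eq_mean.
- exact: (bounded_measurable_mean mu mu b1).
- by apply: bounded_measurableM => //; exact: bounded_measurable_cst.
apply: filterS v0 => x vx.
have bGx : bounded_measurable (fun y => G (x, y)) := bounded_measurable_section1 bG x.
under eq_mean do rewrite -mulrA.
rewrite meanZ; last exact: bounded_measurableM.
rewrite [RHS]mulrC; congr (_ * _).
apply/eqP; rewrite -subr_eq0 -meanZ// -meanB; last 2 first.
- exact: bounded_measurableM.
- by apply: bounded_measurableM => //; exact: bounded_measurable_cst.
by apply/eqP; rewrite -[RHS]vx; apply: eq_mean => y; ring.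
Qed.

End QuasiRandom.

(** * The unit square and the cut distance *)
Section UnitSquare.
Context {R : realType}.
Notation mu := (@unit_law R).
Notation sq := (@unit_itv R `*` @unit_itv R).

Lemma measurable_unit_itv : measurable (@unit_itv R).
Proof. exact: measurable_itv. Qed.

Lemma measurable_unit_square : measurable sq.
Proof. by apply: measurableX; exact: measurable_unit_itv. Qed.

Let idRR : measurableTypeR R * measurableTypeR R -> R * R := id.

Let measurable_idRR : measurable_fun [set: measurableTypeR R * measurableTypeR R] idRR.
Proof. by move=> _ A mA; rewrite setTI. Qed.

Lemma unit_law2_lebesgue2 (C : set (R * R)) : measurable C ->
  (mu \x mu)%E C = lebesgue2 (C `&` sq).
Proof.
move=> mC.
have [m mE] : exists m : {measure set (R * R) -> \bar R}, forall A, m A = lebesgue2 (A `&` sq).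
  have msq : measurable (sq : set (measurableTypeR R * measurableTypeR R)).
    exact: measurable_unit_square.
  by unshelve eexists (pushforward (mrestr (@lebesgue_measure R \x @lebesgue_measure R)%E msq) idRR).
rewrite -mE; apply: product_measure_unique mC => A B mA mB.
rewrite mE -setXI /lebesgue2 product_measure1E//.
- by congr (_ * _)%E; apply/esym; exact: unit_law_lebesgue.
- by apply: measurableI => //; exact: measurable_unit_itv.
- by apply: measurableI => //; exact: measurable_unit_itv.
Qed.

(** Extension by 0 outside the square turns a graph function into a kernel that is
    symmetric and [0,1]-valued on the whole plane, with the same integrals. *)
Definition restrict_square (g : R * R -> R) : R * R -> R := g \_ sq.

Lemma edge_density_unit_law (g : R * R -> R) : graph_function g ->
  edge_density g = \int[(mu \x mu)%E]_z restrict_square g z.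
Proof.
move=> [mg _ g01]; rewrite -Rintegral_mkcond /edge_density /Rintegral; congr fine.
have [m mE] : exists m : {measure set (R * R) -> \bar R},
    (forall A, m A = lebesgue2 A) /\
    (\int[m]_(z in sq) (g z)%:E = \int[lebesgue2]_(z in sq) (g z)%:E)%E.
  unshelve eexists (pushforward (@lebesgue_measure R \x @lebesgue_measure R)%E idRR).
    exact: measurable_idRR.
  split=> //; rewrite ge0_integral_pushforward//.
  - exact: measurable_unit_square.
  - by apply/measurable_EFinP; exact: measurable_funTS.
  - move=> [x y]; rewrite inE => -[/= x1 y1]; rewrite lee_fin.
    by have /andP[] := g01 x y x1 y1.
rewrite -mE.2; apply: eq_measure_integral => A mA Asq.
by rewrite mE.1 -[in LHS](setIidl Asq); apply/esym; exact: unit_law2_lebesgue2.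
Qed.

(** Both sides are measures of [N] that agree on rectangles. *)
Lemma unit_law2_preserved (s : R -> R) (N : set (R * R)) :
  measurable_fun setT s -> (forall A, measurable A -> mu (s @^-1` A) = mu A) ->
  measurable N ->
  (mu \x mu)%E ((fun z => (s z.1, s z.2)) @^-1` N) = (mu \x mu)%E N.
Proof.
move=> ms sE mN.
have mss : measurable_fun setT (fun z : R * R => (s z.1, s z.2)).
  by apply: measurable_fun_pair; exact: measurableT_comp.
have [m mE] : exists m : {measure set (R * R) -> \bar R}, forall A,
    m A = (mu \x mu)%E ((fun z => (s z.1, s z.2)) @^-1` A).
  by unshelve eexists (pushforward (mu \x mu)%E (fun z => (s z.1, s z.2))).
rewrite -mE; apply/esym; apply: product_measure_unique mN => A B mA mB.
rewrite mE (_ : _ @^-1` _ = (s @^-1` A) `*` (s @^-1` B))//.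
rewrite product_measure1E//; [|rewrite -[X in measurable X]setTI; exact: ms..].
by congr (_ * _)%E; exact: sE.
Qed.

Lemma restrict_squareE (g : R * R -> R) x y : unit_itv x -> unit_itv y ->
  restrict_square g (x, y) = g (x, y).
Proof. by move=> x1 y1; rewrite /restrict_square patchE mem_set. Qed.

Lemma measurable_restrict_square (g : R * R -> R) : graph_function g ->
  measurable_fun setT (restrict_square g).
Proof.
move=> [mg _ _]; apply/(measurable_restrictT _ _).1; first exact: measurable_unit_square.
exact: measurable_funTS.
Qed.

Lemma restrict_square_itv (g : R * R -> R) z : graph_function g ->
  0 <= restrict_square g z <= 1.
Proof.
move=> [_ _ g01]; rewrite /restrict_square patchE; case: ifPn => [|_]; last first.
  by rewrite lexx ler01.
by case: z => x y; rewrite inE => -[/= x1 y1]; exact: g01.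
Qed.

Lemma restrict_squareC (g : R * R -> R) x y : graph_function g ->
  restrict_square g (x, y) = restrict_square g (y, x).
Proof.
move=> [_ sg _]; rewrite /restrict_square !patchE !in_setX andbC.
by case: ifPn => // /andP[]; rewrite !inE => x1 y1; exact: sg.
Qed.

(** The set where [g] composed with [s] on both coordinates differs from [p] is,
    inside the square, the preimage of a null set by a map that preserves the
    uniform law of the square. No image of a measurable set under [s] is formed,
    so the measurability of the inverse of [s] is not an issue. *)
Lemma cut_discrepancy_ae_constant (g h : R * R -> R) (p : R) (s : R -> R) :
  graph_function g -> graph_function h -> mp_bijection s ->
  {ae (mu \x mu)%E, forall z, restrict_square g z = p} ->
  cut_discrepancy g h s = cut_discrepancy (cst p) h s.
Proof.
move=> gg gh [ms sbij spres] aep.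
have sI x : unit_itv x -> unit_itv (s x) by case: sbij => sfun _ _; exact: sfun.
(* s is only constrained on the unit interval; its extension by 0 is measurable
   and preserves the uniform law *)
pose s' : R -> R := s \_ unit_itv.
have s'E x : unit_itv x -> s' x = s x by move=> x1; rewrite /s' patchE mem_set.
have ms' : measurable_fun setT s'.
  by apply/(measurable_restrictT _ _).1 => //; exact: measurable_unit_itv.
have s'mu A : measurable A -> mu (s' @^-1` A) = mu A.
  move=> mA; have ms'A : measurable (s' @^-1` A).
    by rewrite -[X in measurable X]setTI; exact: ms'.
  rewrite !unit_law_lebesgue// -(spres (A `&` unit_itv)).
  - congr (lebesgue_measure _); apply/seteqP; split => x /=.
      by move=> [s'x x1]; rewrite -s'E//; split=> //; split=> //; rewrite s'E//; exact: sI.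
    by move=> [x1 [Asx _]]; rewrite s'E.
  - by apply: measurableI => //; exact: measurable_unit_itv.
  - by move=> x [].
pose N : set (R * R) := ~` (restrict_square g @^-1` [set p]).
have mN : measurable N.
  apply: measurableC; rewrite -[X in measurable X]setTI.
  by apply: measurable_restrict_square => //; exact: measurable_set1.
have N0 : (mu \x mu)%E N = 0%E by apply/negligibleP.
pose N' := (fun z : R * R => (s' z.1, s' z.2)) @^-1` N.
have mN' : measurable N'.
  rewrite -[X in measurable X]setTI.
  have : measurable_fun setT (fun z : R * R => (s' z.1, s' z.2)).
    by apply: measurable_fun_pair; exact: measurableT_comp.
  by apply.
have N'0 : lebesgue2 (N' `&` sq) = 0%E.
  rewrite -(unit_law2_lebesgue2 mN') -[RHS]N0.
  exact: (unit_law2_preserved ms' s'mu mN).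
have key S T : measurable S -> S `<=` unit_itv -> measurable T -> T `<=` unit_itv ->
    \int[lebesgue2]_(xy in S `*` T) (g (s xy.1, s xy.2) - h xy) =
    \int[lebesgue2]_(xy in S `*` T) (p - h xy).
  move=> mS SI mT TI; congr fine.
  have STsq : S `*` T `<=` sq by move=> z [/SI ? /TI ?].
  have mh : measurable_fun (S `*` T) h.
    by apply: measurable_funTS; case: gh.
  apply: ae_eq_integral.
  - exact: measurableX.
  - apply/measurable_EFinP.
    have H : measurable_fun (S `*` T) (fun z : R * R => g (s z.1, s z.2)).
      apply: (eq_measurable_fun (fun z : R * R => g (s' z.1, s' z.2))).
        by move=> z; rewrite inE => /STsq[z1 z2]; rewrite !s'E.
      apply: measurable_funTS; apply: measurableT_comp; first by case: gg.
      by apply: measurable_fun_pair; exact: measurableT_comp.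
    exact: (measurable_funB H mh).
  - apply/measurable_EFinP; exact: (measurable_funB (measurable_cst p) mh).
  - exists (N' `&` sq); split.
    + by apply: measurableI => //; exact: measurable_unit_square.
    + exact: N'0.
    + move=> [x y] /not_implyP[xyST Hne].
      have [/= x1 y1] : sq (x, y) := STsq _ xyST; split => //.
      rewrite /N' /N /= => Gp; apply: Hne; rewrite /=.
      rewrite !s'E// restrict_squareE in Gp; [|exact: sI..].
      by rewrite Gp.
congr sup; apply/seteqP; split=> r [S [T [mS SI mT TI ->]]]; exists S, T; split => //.
  by rewrite key.
by rewrite key.
Qed.

End UnitSquare.

Section Transfer.
Context {R : realType} {d} {T : measurableType d} (P : probability T R) (n : nat)
  (X : 'I_n -> {RV P >-> R}) (U : 'I_n -> 'I_n -> {RV P >-> R}) (g : R * R -> R).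

(** The two random graphs coincide as soon as every vertex variable falls in the
    unit interval, which happens almost surely. *)
Lemma mean_real_det_restrict x : graph_function g -> iid_uniform X U ->
  \int[P]_w real_det X U g x w = \int[P]_w real_det X U (restrict_square g) x w.
Proof.
move=> gg [_ law].
apply: ae_eq_mean.
- by apply: bounded_measurable_real_det; case: gg.
- by apply: bounded_measurable_real_det; exact: measurable_restrict_square.
have aeX : {ae P, forall w, forall i, unit_itv (X i w)}.
  apply: filter_forall => i.
  have mX : measurable (X i @^-1` (~` unit_itv)).
    rewrite -[X in measurable X]setTI; apply: measurable_funPT => //.
    by apply: measurableC; exact: measurable_unit_itv.
  exists (X i @^-1` (~` unit_itv)); split => //.
  have -> : P (X i @^-1` (~` unit_itv)) = unit_law (~` unit_itv).
    apply: (law (inl i)); first by rewrite inE.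
    by apply: measurableC; exact: measurable_unit_itv.
  rewrite unit_law_lebesgue; last by apply: measurableC; exact: measurable_unit_itv.
  by rewrite setICl measure0.
apply: filterS aeX => w Xw; rewrite /real_det; congr (\det (_ + _ *: (_ *: _))).
by apply/matrixP => i j; rewrite !mxE /adj /W_graph !restrict_squareE.
Qed.

End Transfer.

Theorem theorem26 (R : realType) (g : R * R -> R) (p : R)
    (d : nat -> measure_display) (T : forall n, measurableType (d n))
    (P : forall n, probability (T n) R)
    (X : forall n, 'I_n -> {RV (P n) >-> R})
    (U : forall n, 'I_n -> 'I_n -> {RV (P n) >-> R}) :
  graph_function g ->
  edge_density g = p ->
  0 < p ->
  (forall n, iid_uniform (X n) (U n)) ->
  cvg_in_probability P
    (fun n w => scaled_det (W_adjacency g (X n) (U n) w) : disc_functions R)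
    (limit_det p : disc_functions R)
  \/
  ((fun z => complex_expectation (P n)
      (fun w => scaled_det (W_adjacency g (X n) (U n) w) z)) : disc_functions R)
    @[n --> \oo] --> (limit_det p : disc_functions R) ->
  graphon g = constant_graphon p.
Proof.
move=> gg gp p0 iid cv.
pose G := restrict_square g.
have mG : measurable_fun setT G by exact: measurable_restrict_square.
have G01 z : 0 <= G z <= 1 by exact: restrict_square_itv.
have symG x y : G (x, y) = G (y, x) by exact: restrict_squareC.
have bG : bounded_measurable G.
  split=> //; exists 1 => z; have /andP[G0 G1] := G01 z.
  by rewrite ger0_norm.
have Gp : \int[(unit_law \x unit_law)%E]_z G z = p.
  by rewrite -edge_density_unit_law.
have p1 : p <= 1.
  rewrite -Gp -[leRHS](mean_cst (unit_law \x unit_law)%E).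
  apply: le_mean => //; first exact: bounded_measurable_cst.
  by move=> z; have /andP[] := G01 z.
have meancv x : `|x| <= 2^-1 ->
    \int[P n]_w real_det (X n) (U n) G x w @[n --> \oo] --> real_limit_det p x.
  move=> x2; have mg : measurable_fun setT g by case: gg.
  rewrite (funext (fun n => esym (mean_real_det_restrict x gg (iid n)))).
  by have H := mean_real_det_cvg mg x2 cv; exact: H.
have [a [C [fT a4]]] : exists a (C : R), taylor4 (real_limit_det p) a 4^-1 C /\
    a 4%N = p ^+ 2 / 8 - p ^+ 4 / 4.
  by apply: real_limit_det_taylor4; rewrite ltW.
have coefcv : \int[P n]_w det_coef (X n) (U n) G 4 w @[n --> \oo] -->
    24^-1 * (3 * p ^+ 2 - 6 * cycle4_density G).
  under eq_fun do rewrite mean_det_coef4// Gp.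
  by apply: cvgM; [exact: cvg_bin4|exact: cvg_cst].
have cycleE : cycle4_density G = p ^+ 4.
  have := @taylor4_coef_limit R _ _ _ _ 4^-1 2 C _ _
    (fun n => mean_real_det_taylor4 (X n) (U n) mG) fT meancv coefcv.
  by rewrite a4 => /(_ ltac:(lra)) E; lra.
have aeG : {ae (unit_law \x unit_law)%E, forall z, G z = p}.
  apply: ae_constant_of_cycle4 => //.
  by move=> z; have /andP[] := G01 z.
rewrite /constant_graphon /graphon; apply/seteqP.
have distE h : graph_function h -> cut_distance g h = cut_distance (cst p) h.
  move=> gh; congr inf; apply/seteqP; split => _ [s ms <-]; exists s => //.
    by rewrite -(cut_discrepancy_ae_constant gg gh ms aeG).
  by rewrite (cut_discrepancy_ae_constant gg gh ms aeG).
by split=> h /= [gh]; rewrite distE.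
Qed.
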